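(* Let $G$ be an acylindrically hyperbolic group with trivial finite radical. Then $G$ is mixed identity free.
   Context: An isometric action of a group $G$ on a metric space $(X,d)$ is acylindrical if for every $\varepsilon>0$ there exist $R,N>0$ such that for all $x,y\in X$ with $d(x,y)\ge R$ there are at most $N$ elements $g\in G$ with $d(x,gx)\le\varepsilon$ and $d(y,gy)\le\varepsilon$. A group is acylindrically hyperbolic if it is not virtually cyclic and admits an acylindrical action on a hyperbolic metric space with unbounded orbits. Its finite radical is its maximal finite normal subgroup (which exists and is unique). Let $F_n$ be the free group of rank $n$. A group $G$ satisfies a mixed identity $w=1$, $w\in G\ast F_n$, if every homomorphism $G\ast F_n\to G$ that is the identity on $G$ sends $w$ to $1$; the mixed identity is non-trivial if $w\ne1$ in $G\ast F_n$. $G$ is mixed identity free (MIF) if it satisfies no non-trivial mixed identity (for any $n$). *)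

(* Defs.v *)
From HB Require Import structures.
From mathcomp Require Import all_boot all_order all_algebra.
From mathcomp Require Import generic_quotient.
From mathcomp Require Import all_classical all_reals.
From mathcomp Require Import topology.

Set Implicit Arguments.
Unset Strict Implicit.
Unset Printing Implicit Defensive.

Import Order.TTheory GRing.Theory Num.Theory.

Local Open Scope quotient_scope.
Local Open Scope classical_set_scope.
Local Open Scope card_scope.
Local Open Scope ring_scope.

(* The word (x1, b1) ... (xn, bn) over X * bool stands for x1^e1 ... xn^en,
   where ei = 1 if bi = true and ei = -1 if bi = false. *)
Notation word X := (seq (X * bool)).

Definition flip {X : Type} (a : X * bool) : X * bool := (a.1, ~~ a.2).

Inductive word_eq {X : Type} (rels : set (word X)) : word X -> word X -> Prop :=
| word_eq_refl u : word_eq rels u u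
| word_eq_sym u v : word_eq rels u v -> word_eq rels v u
| word_eq_trans v u w : word_eq rels u v -> word_eq rels v w -> word_eq rels u w
| word_eq_cat u u' v v' :
    word_eq rels u u' -> word_eq rels v v' -> word_eq rels (u ++ v) (u' ++ v')
| word_eq_cancel a : word_eq rels [:: a; flip a] [::]
| word_eq_rel r : rels r -> word_eq rels r [::].

Section Presentation.
Context {X : choiceType} (rels : set (word X)).

Let eqw (u v : word X) : bool := `[< word_eq rels u v >].

Lemma word_eq_is_equiv : equiv_class_of eqw.
Proof.
split=> [u|u v|v u w].
- exact/asboolP/word_eq_refl.
- by apply/asboolP/asboolP => /word_eq_sym.
- move=> /asboolP uv /asboolP vw; exact/asboolP/(word_eq_trans uv vw).
Qed.

Definition word_equiv : equiv_rel (word X) := EquivRelPack word_eq_is_equiv.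

Definition presented : Type := {eq_quot word_equiv}.
HB.instance Definition _ := EqQuotient.on presented.
HB.instance Definition _ := Choice.on presented.

Definition word_class (u : word X) : presented := \pi_presented u.

Lemma word_classP u v : word_class u = word_class v <-> word_eq rels u v.
Proof.
split=> [/eqquotP/asboolP//|uv].
by apply/eqquotP/asboolP.
Qed.

Lemma word_class_repr (x : presented) : word_class (repr x) = x.
Proof. exact: reprK. Qed.

Definition pmul (x y : presented) : presented := word_class (repr x ++ repr y).
Definition pinv (x : presented) : presented :=
  word_class (map flip (rev (repr x))).

Lemma word_eq_repr u : word_eq rels (repr (word_class u)) u.
Proof. by apply/word_classP; rewrite word_class_repr. Qed.

Lemma pmulE u v : pmul (word_class u) (word_class v) = word_class (u ++ v).
Proof. by apply/word_classP/word_eq_cat; exact: word_eq_repr. Qed.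

Lemma word_eq_mulV u : word_eq rels (u ++ map flip (rev u)) [::].
Proof.
elim: u => [|a u IHu]; first exact: word_eq_refl.
rewrite rev_cons map_rcons -cats1.
have -> : (a :: u) ++ map flip (rev u) ++ [:: flip a]
    = [:: a] ++ (u ++ map flip (rev u)) ++ [:: flip a] by rewrite /= catA.
apply: (word_eq_trans _ (word_eq_cancel rels a)).
apply: (word_eq_cat (word_eq_refl _ [:: a])).
exact: (word_eq_cat IHu (word_eq_refl _ _)).
Qed.

Lemma flipK : involutive (@flip X).
Proof. by case=> x b; rewrite /flip /= negbK. Qed.

Lemma word_eq_Vmul u : word_eq rels (map flip (rev u) ++ u) [::].
Proof.
have := word_eq_mulV (map flip (rev u)).
by rewrite -map_rev revK -map_comp (eq_map flipK) map_id.
Qed.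

Lemma pmulA : associative pmul.
Proof.
move=> x y z; rewrite -(word_class_repr x) -(word_class_repr y).
by rewrite -(word_class_repr z) !pmulE catA.
Qed.

Lemma pmul1g : left_id (word_class [::]) pmul.
Proof. by move=> x; rewrite -(word_class_repr x) pmulE. Qed.

Lemma pmulg1 : right_id (word_class [::]) pmul.
Proof. by move=> x; rewrite -(word_class_repr x) pmulE cats0. Qed.

Lemma pmulVg : left_inverse (word_class [::]) pinv pmul.
Proof.
move=> x; rewrite -{2}(word_class_repr x) pmulE.
by apply/word_classP; exact: word_eq_Vmul.
Qed.

Lemma pmulgV : right_inverse (word_class [::]) pinv pmul.
Proof.
move=> x; rewrite -{1}(word_class_repr x) pmulE.
by apply/word_classP; exact: word_eq_mulV.
Qed.

HB.instance Definition _ :=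
  isGroup.Build presented pmulA pmul1g pmulg1 pmulVg pmulgV.

Definition pgen (x : X) : presented := word_class [:: (x, true)].

End Presentation.

Definition free_group (X : choiceType) : groupType := @presented X set0.

Definition free_gen {X : choiceType} (x : X) : free_group X := pgen set0 x.

Section FreeProduct.
Context (G H : groupType).

Variant free_product_rels : set (word (G + H)%type) :=
| free_product_rell (x y : G) : free_product_rels
    [:: (inl x, true); (inl y, true); (inl (x * y)%g, false)]
| free_product_relr (x y : H) : free_product_rels
    [:: (inr x, true); (inr y, true); (inr (x * y)%g, false)].

Definition free_product : groupType := presented free_product_rels.

Definition fpl (x : G) : free_product := pgen free_product_rels (inl x).
Definition fpr (y : H) : free_product := pgen free_product_rels (inr y).

End FreeProduct.

Arguments fpl {G H} x.
Arguments fpr {G H} y.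

Section PresentedUniversal.
Context {X : choiceType} (rels : set (word X)) (K : groupType) (f : X -> K).

Definition word_eval (u : word X) : K :=
  foldr (fun a k => ((if a.2 then f a.1 else (f a.1)^-1) * k)%g) 1%g u.

Lemma word_eval_cat u v : word_eval (u ++ v) = (word_eval u * word_eval v)%g.
Proof. by elim: u => [|a u IHu] /=; rewrite ?mul1g// IHu mulgA. Qed.

Lemma word_class_cat u v :
  word_class rels (u ++ v) = (word_class rels u * word_class rels v)%g.
Proof. by rewrite -pmulE. Qed.

Lemma word_class_flip a :
  word_class rels [:: flip a] = (word_class rels [:: a])^-1%g.
Proof.
apply/(@mulgI _ (word_class rels [:: a])); rewrite mulgV -word_class_cat.
by apply/word_classP; exact: word_eq_cancel.
Qed.

Lemma presented_morphE (h : {multiplicative presented rels -> K}) :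
  (forall x, h (pgen rels x) = f x) ->
  forall u, h (word_class rels u) = word_eval u.
Proof.
move=> hf.
have h1 : h 1%g = 1%g by apply: (@mulgI _ (h 1%g)); rewrite -gmulfM !mulg1.
have hV y : h y^-1%g = (h y)^-1%g.
  by apply: (@mulgI _ (h y)); rewrite -gmulfM !mulgV.
elim=> [|[x b] u IHu]; first exact: h1.
rewrite -cat1s word_class_cat gmulfM IHu; congr (_ * _)%g.
case: b => /=; first exact: hf.
by rewrite (word_class_flip (x, true)) hV; congr (_^-1)%g; exact: hf.
Qed.

Hypothesis frels : forall r, rels r -> word_eval r = 1%g.

Lemma word_eq_eval u v : word_eq rels u v -> word_eval u = word_eval v.
Proof.
elim=> {u v} [//|u v _ -> //|v u w _ -> _ -> //|u u' v v' _ e _ e'| |r /frels//].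
  by rewrite !word_eval_cat e e'.
by move=> [x []] /=; rewrite mulg1 ?mulgV ?mulVg.
Qed.

Lemma presented_universal :
  exists h : {multiplicative presented rels -> K},
    forall x, h (pgen rels x) = f x.
Proof.
pose h (w : presented rels) := word_eval (repr w).
have hE u : h (word_class rels u) = word_eval u.
  by apply: word_eq_eval; exact: word_eq_repr.
have hM : {morph h : x y / (x * y)%g}.
  move=> x y; rewrite -(word_class_repr x) -(word_class_repr y).
  by rewrite -word_class_cat !hE word_eval_cat.
pose hh := HB.pack_for {multiplicative presented rels -> K} h
  (isMultiplicative.Build _ _ h hM).
by exists hh => x; rewrite [LHS]hE /= mulg1.
Qed.

End PresentedUniversal.

Lemma presented_morph_uniq (X : choiceType) (rels : set (word X)) (K : groupType)
    (h h' : {multiplicative presented rels -> K}) :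
  (forall x, h (pgen rels x) = h' (pgen rels x)) -> h =1 h'.
Proof.
move=> hh' w; rewrite -(word_class_repr w).
rewrite (presented_morphE hh').
by rewrite (@presented_morphE _ _ _ (h' \o pgen rels)).
Qed.

Lemma free_group_universal (X : choiceType) (K : groupType) (f : X -> K) :
  exists h : {multiplicative free_group X -> K},
    (forall x, h (free_gen x) = f x) /\
    forall h' : {multiplicative free_group X -> K},
      (forall x, h' (free_gen x) = f x) -> h' =1 h.
Proof.
have [h hf] := @presented_universal X set0 K f (fun r => False_ind _).
exists h; split=> // h' h'f; apply: presented_morph_uniq => x.
by rewrite [LHS]h'f [RHS]hf.
Qed.

Section FreeProductUniversal.
Context (G H : groupType).

Lemma fplM (x y : G) : fpl (x * y)%g = (fpl x * fpl y)%g :> free_product G H.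
Proof.
have /word_classP := word_eq_rel (@free_product_rell G H x y).
rewrite (word_class_cat _ [:: _] [:: _; _]) (word_class_cat _ [:: _] [:: _]).
have := word_class_flip (@free_product_rels G H) (inl (x * y)%g, true).
by rewrite /flip/= => ->; rewrite mulgA => /divg1_eq/esym.
Qed.

Lemma fprM (x y : H) : fpr (x * y)%g = (fpr x * fpr y)%g :> free_product G H.
Proof.
have /word_classP := word_eq_rel (@free_product_relr G H x y).
rewrite (word_class_cat _ [:: _] [:: _; _]) (word_class_cat _ [:: _] [:: _]).
have := word_class_flip (@free_product_rels G H) (inr (x * y)%g, true).
by rewrite /flip/= => ->; rewrite mulgA => /divg1_eq/esym.
Qed.

HB.instance Definition _ := isMultiplicative.Build G (free_product G H) fpl fplM.
HB.instance Definition _ := isMultiplicative.Build H (free_product G H) fpr fprM.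

Lemma free_product_universal (K : groupType)
    (f : {multiplicative G -> K}) (g : {multiplicative H -> K}) :
  exists h : {multiplicative free_product G H -> K},
    [/\ forall x, h (fpl x) = f x, forall y, h (fpr y) = g y &
     forall h' : {multiplicative free_product G H -> K},
       (forall x, h' (fpl x) = f x) -> (forall y, h' (fpr y) = g y) -> h' =1 h].
Proof.
pose fg (z : (G + H)%type) : K := match z with inl x => f x | inr y => g y end.
have fgrel r : free_product_rels r -> word_eval fg r = 1%g.
  by case=> x y /=; rewrite gmulfM mulg1 mulgA mulgV.
have [h hfg] := presented_universal fgrel.
exists h; split=> [x|y|h' h'f h'g]; [exact: hfg|exact: hfg|].
apply: presented_morph_uniq => -[x|y].
  by rewrite [LHS]h'f [RHS]hfg.
by rewrite [LHS]h'g [RHS]hfg.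
Qed.

End FreeProductUniversal.

Definition satisfies_mixed_identity (G : groupType) (n : nat)
    (w : free_product G (free_group 'I_n)) : Prop :=
  forall f : {multiplicative free_product G (free_group 'I_n) -> G},
    (forall g, f (fpl g) = g) -> f w = 1%g.

Definition mixed_identity_free (G : groupType) : Prop :=
  ~ exists (n : nat) (w : free_product G (free_group 'I_n)),
      w <> 1%g /\ satisfies_mixed_identity w.

Definition is_subgroup {G : groupType} (H : set G) : Prop :=
  group_closed [in H].

Definition is_normal_subgroup {G : groupType} (H : set G) : Prop :=
  is_subgroup H /\ forall x g, H x -> H (x ^ g)%g.

Definition finite_index {G : groupType} (H : set G) : Prop :=
  finite_set (range (fun g : G => [set (g * h)%g | h in H])).

Definition cyclic_subgroup {G : groupType} (a : G) : set G :=
  [set x | exists k : nat, x = (a ^+ k)%g \/ x = (a ^- k)%g].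

Definition virtually_cyclic (G : groupType) : Prop :=
  exists a : G, finite_index (cyclic_subgroup a).

Definition is_finite_radical {G : groupType} (K : set G) : Prop :=
  [/\ is_normal_subgroup K, finite_set K &
      forall L : set G, is_normal_subgroup L -> finite_set L ->
        K `<=` L -> L = K].

Section Hyperbolic.
Context {R : realType}.

Definition is_geodesic {X : metricType R} (x y : X) (c : R -> X) : Prop :=
  [/\ c 0 = x, c (mdist x y) = y &
      {in `[0, mdist x y] &, forall s t, mdist (c s) (c t) = `|s - t|}].

Definition geodesic_space (X : metricType R) : Prop :=
  forall x y : X, exists c, is_geodesic x y c.

Definition slim_triangles (X : metricType R) (delta : R) : Prop :=
  forall (x y z : X) (cxy cyz cxz : R -> X),
    is_geodesic x y cxy -> is_geodesic y z cyz -> is_geodesic x z cxz ->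
    forall t, t \in `[0, mdist x y] ->
      (exists2 s, s \in `[0, mdist y z] & mdist (cxy t) (cyz s) <= delta) \/
      (exists2 s, s \in `[0, mdist x z] & mdist (cxy t) (cxz s) <= delta).

(* Hyperbolic spaces are required to be geodesic: with Gromov's four-point
   condition on arbitrary metric spaces, every countable infinite group would
   act acylindrically with unbounded orbits on a hyperbolic space (take
   ln (1 + d) for d a proper left-invariant metric). *)
Definition hyperbolic_space (X : metricType R) : Prop :=
  geodesic_space X /\ exists delta : R, slim_triangles X delta.

Definition is_isometric_action {G : groupType} {X : metricType R}
    (act : G -> X -> X) : Prop :=
  [/\ forall x, act 1%g x = x,
      forall g h x, act (g * h)%g x = act g (act h x) &
      forall g x y, mdist (act g x) (act g y) = mdist x y].

Definition acylindrical {G : groupType} {X : metricType R}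
    (act : G -> X -> X) : Prop :=
  forall eps : R, 0 < eps ->
  exists (r : R) (N : nat), [/\ 0 < r, (0 < N)%N &
    forall x y : X, r <= mdist x y ->
      [set g : G | mdist x (act g x) <= eps /\ mdist y (act g y) <= eps]
        #<= `I_N].

Definition mbounded {X : metricType R} (A : set X) : Prop :=
  exists M : R, forall x y, A x -> A y -> mdist x y <= M.

Definition unbounded_orbits {G : groupType} {X : metricType R}
    (act : G -> X -> X) : Prop :=
  forall x : X, ~ mbounded (range (act ^~ x)).

End Hyperbolic.

(* X is required to be nonempty, since on the empty space every group acts
   with (vacuously) unbounded orbits. *)
Definition acylindrically_hyperbolic (R : realType) (G : groupType) : Prop :=
  ~ virtually_cyclic G /\
  exists (X : metricType R) (act : G -> X -> X),
    [/\ inhabited X, hyperbolic_space X, is_isometric_action act,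
        acylindrical act & unbounded_orbits act].

(* Main.v *)
(** Fix a loxodromic element [a] whose powers all have the same centralizer, and
    let [E] be the stabilizer of its pair of limit points. If the consecutive
    coefficients of [c0 a^{e1 M} c1 a^{e2 M} ... ck] do not map the limit point at
    the end of one power to the one at the start of the next, the broken geodesic
    it labels has large steps and bounded Gromov products, so the product is
    nontrivial for large [M]. Substituting [x_i := e_i a^M e_i'^-1] in a reduced
    word with coefficients in [S] produces such a product as soon as the [e]'s
    translate the limit points of [a] to points in general position with respect to [S].
    Such [e]'s exist by B. H. Neumann's lemma on coset coverings: [E] has infinite
    index, and so has the centralizer of every [s <> 1], because finite conjugacy
    classes lie in the finite radical.

    A loxodromic element exists: otherwise all orbit directions agree, and arbitrarily
    many elements move two far apart points by a bounded amount, against acylindricity. *)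
Require Import Defs.
From mathcomp Require Import all_boot all_order all_algebra.
From mathcomp Require Import all_classical all_reals.
From mathcomp Require Import topology lra zify.

Set Implicit Arguments.
Unset Strict Implicit.
Unset Printing Implicit Defensive.

Import Order.TTheory GRing.Theory Num.Theory.

Local Open Scope classical_set_scope.
Local Open Scope ring_scope.

(** * Gromov products *)

Section GromovProduct.
Context {R : realType} {T : Type} (D : T -> T -> R).

Definition gromov (z x y : T) : R := (D z x + D z y - D x y) / 2.

Definition pseudodist : Prop :=
  [/\ forall x, D x x = 0, forall x y, D x y = D y x &
      forall x y z, D x z <= D x y + D y z].

(* The four-point inequality [(x|z) >= min ((x|y), (y|z)) - delta]. *)
Definition four_point (delta : R) : Prop := forall o x y z,
  gromov o x y <= gromov o x z + delta \/ gromov o y z <= gromov o x z + delta.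

Hypothesis hD : pseudodist.

Lemma dist_ge0 x y : 0 <= D x y.
Proof. by case: hD => D0 Ds Dt; have := Dt x y x; rewrite D0 (Ds y x); lra. Qed.

Lemma gromovC z x y : gromov z x y = gromov z y x.
Proof. by case: hD => _ Ds _; rewrite /gromov (Ds x y); lra. Qed.

Lemma gromov_ge0 z x y : 0 <= gromov z x y.
Proof. by case: hD => _ Ds Dt; have := Dt x z y; rewrite /gromov (Ds x z); lra. Qed.

Lemma gromov_lel z x y : gromov z x y <= D z x.
Proof. by case: hD => _ Ds Dt; have := Dt z x y; rewrite /gromov; lra. Qed.

Lemma gromov_ler z x y : gromov z x y <= D z y.
Proof. by rewrite gromovC gromov_lel. Qed.

Lemma gromov_add z x y : gromov z x y + gromov x z y = D z x.
Proof. by case: hD => _ Ds _; rewrite /gromov (Ds x z); lra. Qed.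

Lemma gromov_base z w x y : gromov z x y <= gromov w x y + D z w.
Proof.
by case: hD => _ _ Dt; have := Dt z w x; have := Dt z w y; rewrite /gromov; lra.
Qed.

Lemma gromov_shift z x y y' : gromov z x y <= gromov z x y' + D y y'.
Proof.
case: hD => _ Ds Dt; have := Dt z y' y; have := Dt x y y'.
by rewrite /gromov (Ds y' y); lra.
Qed.

Lemma gromov_dist_ge z x y : D z x - D x y <= gromov z x y.
Proof.
by case: hD => _ Ds Dt; have := Dt z y x; rewrite /gromov (Ds y x); lra.
Qed.

Lemma gromov_zz z y : gromov z z y = 0.
Proof. by case: hD => D0 _ _; rewrite /gromov D0; lra. Qed.

Lemma dist_gromov z x y : D x y = D z x + D z y - 2 * gromov z x y.
Proof. by rewrite /gromov; lra. Qed.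

(* [o] and [o'] are both coarse centers of a tripod with far away endpoints
   [x i], [y i], so they are close. *)
Lemma coarse_center_dist (delta C r : R) (o o' x1 x2 x3 y1 y2 y3 : T) :
  four_point delta -> 0 <= delta ->
  gromov o x1 x2 <= C -> gromov o x1 x3 <= C -> gromov o x2 x3 <= C ->
  gromov o' y1 y2 <= C -> gromov o' y1 y3 <= C -> gromov o' y2 y3 <= C ->
  D x1 y1 <= r -> D x2 y2 <= r -> D x3 y3 <= r ->
  r + 2 * D o o' + C + 4 * delta < D o x1 ->
  r + 2 * D o o' + C + 4 * delta < D o x2 ->
  r + 2 * D o o' + C + 4 * delta < D o x3 ->
  D o o' <= 2 * C + 5 * delta.
Proof.
move=> h4 d0 h12 h13 h23 k12 k13 k23 r1 r2 r3 l1 l2 l3.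
have D0 := @dist_ge0.
have [_ Ds Dt] := hD.
(* Along the chain [x'], [x], [o], [y], [y'], consecutive Gromov products at [o'] are large unless
   [o] is close to [o'], whereas [(x'|y')] is at most [C]. *)
have main x y x' y' : gromov o x y <= C -> gromov o' x' y' <= C ->
    D x x' <= r -> D y y' <= r ->
    r + 2 * D o o' + C + 4 * delta < D o x ->
    r + 2 * D o o' + C + 4 * delta < D o y ->
    gromov o o' x <= C + delta -> gromov o o' y <= C + delta ->
    D o o' <= 2 * C + 5 * delta.
  move=> hxy hxy' rx ry lx ly gx gy.
  have ax := gromov_add o o' x; have ay := gromov_add o o' y.
  have bx := gromov_dist_ge o' x x'; have b_y := gromov_dist_ge o' y y'.
  have tx := Dt o o' x; have ty := Dt o o' y.
  have s : gromov o' y' y = gromov o' y y' by exact: gromovC.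
  have s2 : gromov o' x' x = gromov o' x x' by exact: gromovC.
  have s3 : gromov o' x o = gromov o' o x by exact: gromovC.
  have dx := D0 o o'.
  have := h4 o' x' x y'; have := h4 o' x y y'; have := h4 o' x o y.
  by case=> ?; case=> ?; case=> ?; lra.
(* At most one of the products [(o'|xi)] at [o] exceeds [C + delta], since two such would push
   [(xi|xj)] above [C]; [main] takes the other two. *)
have [g1|g1] := lerP (gromov o o' x1) (C + delta).
  have [g2|g2] := lerP (gromov o o' x2) (C + delta); first exact: (main x1 x2 y1 y2).
  have [g3|g3] := lerP (gromov o o' x3) (C + delta); first exact: (main x1 x3 y1 y3).
  by have := h4 o x2 o' x3; rewrite (gromovC o x2 o'); case; lra.
have [g2|g2] := lerP (gromov o o' x2) (C + delta); last first.
  by have := h4 o x1 o' x2; rewrite (gromovC o x1 o'); case; lra.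
have [g3|g3] := lerP (gromov o o' x3) (C + delta); last first.
  by have := h4 o x1 o' x3; rewrite (gromovC o x1 o'); case; lra.
exact: (main x2 x3 y2 y3).
Qed.

End GromovProduct.

Lemma mdist_pseudodist {R : realType} (X : metricType R) :
  pseudodist (@mdist R X).
Proof.
split; [exact: mdistxx|exact: metric_sym|].
by move=> x y z; exact: metric_triangle.
Qed.

(** * Slim triangles and the four-point inequality *)

Section SlimTriangles.
Context {R : realType} {X : metricType R}.

Lemma geodesic_point (x y : X) (c : R -> X) (t : R) : is_geodesic x y c ->
  0 <= t <= mdist x y ->
  mdist x (c t) = t /\ mdist (c t) y = mdist x y - t.
Proof.
move=> [c0 c1 cd] /andP[t0 t1].
have l0 : 0 <= mdist x y by lra.
split.
  by rewrite -{1}c0 cd ?in_itv/= ?lexx ?t0//= sub0r normrN ger0_norm.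
rewrite -{1}c1 cd ?in_itv/= ?lexx ?t0 ?t1 ?l0//= distrC ger0_norm//; lra.
Qed.

Lemma gromov_le_dist_geodesic (o x y p : X) :
  mdist x p + mdist p y = mdist x y -> gromov mdist o x y <= mdist o p.
Proof.
have [_ Ds Dt] := @mdist_pseudodist R X.
move=> h; have := Dt o p x; have := Dt o p y; rewrite /gromov (Ds p x); lra.
Qed.

(** The point [p] at distance [(o|z)_x] from [x] on the side [x z] is within [(x|z)_o + 2 * delta]
    of [o]. Slimness puts [p] within [delta] of the side [x y] or [z y], and a Gromov product is at
    most the distance to a geodesic. *)
Lemma slim_four_point (delta : R) : geodesic_space X -> slim_triangles X delta ->
  four_point (@mdist R X) (3 * delta).
Proof.
move=> hgeo hslim o x y z.
have hX := @mdist_pseudodist R X; have [_ Ds Dt] := hX.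
have [cxz gxz] := hgeo x z; have [czo gzo] := hgeo z o; have [cxo gxo] := hgeo x o.
have [cxy gxy] := hgeo x y; have [czy gzy] := hgeo z y.
have [t tE0] : exists t, t = gromov mdist x o z by exists (gromov mdist x o z).
have tE : 0 <= t <= mdist x z by rewrite tE0 gromov_ge0 ?gromov_ler.
have [px pz] := geodesic_point gxz tE.
have tI : t \in `[0, mdist x z] by rewrite in_itv/=.
have tdef : t = (mdist x o + mdist x z - mdist o z) / 2 by [].
set p := cxz t in px pz.
have op : mdist o p <= gromov mdist o x z + 2 * delta.
  have e : gromov mdist o x z = (mdist o x + mdist o z - mdist x z) / 2 by [].
  have [[s sI qd]|[s sI qd]] := hslim _ _ _ _ _ _ gxz gzo gxo _ tI;
    rewrite in_itv/= in sI; move: qd; rewrite -/p.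
    have [q1 q2] := geodesic_point gzo sI => qd.
    have := Dt o (czo s) p; have := Dt z (czo s) p.
    move: qd q1 q2 pz e tdef; rewrite (Ds (czo s) p) (Ds o (czo s)) (Ds z o) (Ds p z) (Ds x o) => *; lra.
  have [q1 q2] := geodesic_point gxo sI => qd.
  have := Dt o (cxo s) p; have := Dt x (cxo s) p.
  move: qd q1 q2 px e tdef; rewrite (Ds (cxo s) p) (Ds o (cxo s)) (Ds o x) => *; lra.
have slim2 := hslim _ _ _ _ _ _ gxz gzy gxy _ tI.
case: slim2 => -[s sI qd]; rewrite in_itv/= in sI; move: qd; rewrite -/p => qd.
  have [q1 q2] := geodesic_point gzy sI.
  right; have : gromov mdist o z y <= mdist o (czy s).
    by apply: gromov_le_dist_geodesic; rewrite q1 q2; lra.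
  have := Dt o p (czy s); rewrite (gromovC hX o y z); lra.
have [q1 q2] := geodesic_point gxy sI.
left; have : gromov mdist o x y <= mdist o (cxy s).
  by apply: gromov_le_dist_geodesic; rewrite q1 q2; lra.
have := Dt o p (cxy s); lra.
Qed.

End SlimTriangles.

(** * Left-invariant hyperbolic distances *)

Section LeftInvariant.
Context {R : realType} {G : groupType} (D : G -> G -> R) (delta : R).

Definition left_invariant : Prop :=
  forall g x y : G, D (g * x)%g (g * y)%g = D x y.

Hypotheses (hD : pseudodist D) (hinv : left_invariant).
Hypotheses (h4 : four_point D delta) (delta_gt0 : 0 < delta).

Local Notation len := (D 1%g).
Local Notation gp := (gromov D 1%g).

Lemma dist_len x y : D x y = len (x^-1 * y)%g.
Proof. by rewrite -(hinv x^-1%g) mulVg. Qed.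

Lemma len1 : len 1%g = 0.
Proof. by case: hD => + _ _; exact. Qed.

Lemma len_ge0 g : 0 <= len g.
Proof. exact: dist_ge0. Qed.

Lemma lenV g : len g^-1%g = len g.
Proof. by case: hD => _ Ds _; rewrite -(hinv g) mulg1 mulgV Ds. Qed.

Lemma lenM g h : len (g * h)%g <= len g + len h.
Proof.
case: hD => _ _ Dt; apply: le_trans (Dt _ g _) _.
by rewrite -{2}(mulg1 g) hinv.
Qed.

Lemma lenX g n : len (g ^+ n)%g <= n%:R * len g.
Proof.
elim: n => [|n IHn]; first by rewrite len1 mul0r.
rewrite expgS -natr1 mulrDl mul1r addrC.
by apply: le_trans (lenM _ _) _; rewrite lerD2l.
Qed.

Lemma gromov_left g z x y :
  gromov D (g * z)%g (g * x)%g (g * y)%g = gromov D z x y.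
Proof. by rewrite /gromov !hinv. Qed.

Lemma gp_mul g h : gp g (g * h)%g = len g - gp g^-1%g h.
Proof.
have := gromov_add hD 1%g g (g * h)%g.
by rewrite -(gromov_left g^-1%g g) mulg1 mulVg mulKg; lra.
Qed.

Lemma lenM_gp g h : len (g * h)%g = len g + len h - 2 * gp g^-1%g h.
Proof.
have := dist_gromov D 1%g g^-1%g h.
by rewrite dist_len invgK lenV.
Qed.

(** Local-to-global principle for broken geodesics, by induction from the right end. If [w] is the
    product of the steps after [u], then [(u|u * w)] exceeds [C + delta], so the four-point
    inequality transfers the bound on [(u0^-1|u)] to [(u0^-1|u * w)]; the loss of one [delta] does
    not accumulate. *)
Lemma len_gap_chain (C l : R) (u0 : G) (s : seq G) :
  0 <= C -> 2 * C + 2 * delta < l ->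
  path (fun u v => gp u^-1%g v <= C) u0 s -> all (fun u => l <= len u) s ->
  gp u0^-1%g (\prod_(u <- s) u)%g <= C + delta /\
  (size s)%:R * (l - 2 * C - 2 * delta) <= len (\prod_(u <- s) u)%g.
Proof.
move=> C0 Cl; elim: s u0 => [|u s IHs] u0 /=.
  rewrite big_nil len1 mul0r lexx (gromovC hD) gromov_zz//; split=> //.
  by rewrite addr_ge0// ltW.
move=> /andP[u0u us] /andP[lu ls]; rewrite big_cons.
have [IH1 IH2] := IHs _ us ls.
have e := gp_mul u (\prod_(v <- s) v)%g.
split; last by rewrite lenM_gp -natr1 mulrDl mul1r; lra.
by have := h4 1%g u0^-1%g (u * \prod_(v <- s) v)%g u; 
   rewrite (gromovC hD 1%g (u * _)%g u); case=> ?; lra.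
Qed.

(* Together, the conditions make the powers of [c] a quasigeodesic line. *)
Definition loxodromic (C k : R) (c : G) : Prop :=
  [/\ 0 < k, forall i j, gp (c ^- i)%g (c ^+ j)%g <= C &
      forall n, n%:R * k <= len (c ^+ n)%g].

Lemma prod_nseq (c : G) n : (\prod_(u <- nseq n c) u = c ^+ n)%g.
Proof. by elim: n => [|n IHn]; rewrite ?big_nil//= big_cons IHn expgS. Qed.

(** As [len (c * c) = 2 * len c - 2 * (c^-1|c)], the hypothesis gives what [len_gap_chain] asks of
    the constant sequences [c] and [c^-1]. *)
Lemma loxodromic_criterion c : len c + 3 * delta < len (c * c)%g ->
  exists C k, loxodromic C k c.
Proof.
move=> hc; have d0 := delta_gt0; have ec := lenM_gp c c.
have C00 : 0 <= gp c^-1%g c by exact: gromov_ge0.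
move: C00 ec; move C0E : (gp c^-1%g c) => C0 C00 ec.
have Cl : 2 * C0 + 2 * delta < len c by lra.
have pathc n : path (fun u v => gp u^-1%g v <= C0) c (nseq n c).
  by elim: n => //= n ->; rewrite C0E lexx.
have pathV n : path (fun u v => gp u^-1%g v <= C0) c^-1%g (nseq n c^-1%g).
  by elim: n => //= n ->; rewrite invgK (gromovC hD) C0E lexx.
have allc n : all (fun u => len c <= len u) (nseq n c).
  by rewrite all_nseq lexx orbT.
have allV n : all (fun u => len c <= len u) (nseq n c^-1%g).
  by rewrite all_nseq lenV lexx orbT.
have pos n := len_gap_chain C00 Cl (pathc n) (allc n).
have neg n := len_gap_chain C00 Cl (pathV n) (allV n).
exists (C0 + 2 * delta), (len c - 2 * C0 - 2 * delta); split; first lra.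
- move=> i [|j]; first by rewrite (gromovC hD) gromov_zz//; lra.
  have [p _] := pos j; have [q _] := neg i.
  rewrite prod_nseq in p; rewrite prod_nseq invgK expVgn in q.
  have := gp_mul c (c ^+ j)%g; rewrite -expgS => e.
  by have := h4 1%g c (c ^+ j.+1)%g (c ^- i)%g; rewrite (gromovC hD 1%g (c ^+ _)%g); case=> ?; lra.
- by move=> n; have [_] := pos n; rewrite prod_nseq size_nseq.
Qed.

(** Suppose the bound fails. As [g] and [h] violate the criterion, each has a large Gromov product
    with its own inverse, so [g^-1] diverges from [h], and [g] from [h^-1]; then [g * h] satisfies
    the criterion. *)
Lemma no_loxodromic_gp : (forall c, len (c * c)%g <= len c + 3 * delta) ->
  forall g h, Num.min (len g) (len h) <= 2 * gp g h + 6 * delta.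
Proof.
move=> hno g h; have d0 := delta_gt0; rewrite leNgt; apply/negP; rewrite lt_min => /andP[lg lh].
have cg := lenM_gp g g; have ch := lenM_gp h h.
have ng := hno g; have nh := hno h; have ngh := hno (g * h)%g.
have gh0 : 0 <= gp g h by exact: gromov_ge0.
have gVh : gp g^-1%g h <= gp g h + delta.
  by have := h4 1%g g g^-1%g h; rewrite (gromovC hD _ g g^-1%g); case=> ?; lra.
have hVg : gp h^-1%g g <= gp g h + delta.
  have := h4 1%g h h^-1%g g.
  by rewrite (gromovC hD _ h h^-1%g) (gromovC hD _ h g); case=> ?; lra.
have e1 := gp_mul h^-1%g g^-1%g; rewrite lenV invgK -invgM in e1.
have e2 := gp_mul g h.
have e3 := lenM_gp g h; have e4 := lenM_gp (g * h)%g (g * h)%g.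
rewrite (gromovC hD _ h g^-1%g) in e1.
have s1 : gp h^-1%g (g * h)%g <= gp g h + 2 * delta.
  have := h4 1%g g (g * h)%g h^-1%g.
  by rewrite (gromovC hD _ (g * h)%g) (gromovC hD _ g h^-1%g); case=> ?; lra.
by have := h4 1%g h^-1%g (g * h)^-1%g (g * h)%g; case=> ?; lra.
Qed.

End LeftInvariant.

(** * Existence of loxodromic elements *)

Lemma seq_bounded (R : realType) (T : eqType) (s : seq T) (f : T -> R) :
  exists2 M : R, 0 <= M & forall x, x \in s -> f x <= M.
Proof.
elim: s => [|y s [M M0 IHs]]; first by exists 0.
exists (Num.max M (f y)); first by rewrite le_max M0.
by move=> x; rewrite inE le_max => /predU1P[->|/IHs ->//]; rewrite lexx orbT.
Qed.

Lemma card_le_size (T : eqType) (A : set T) (n : nat) (s : seq T) :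
  (A #<= `I_n)%card -> uniq s -> (forall x, x \in s -> A x) -> (size s <= n)%N.
Proof.
case: s => [//|x0 s'] An; set s := x0 :: s' => us sA.
rewrite -card_le_II; apply: card_le_trans An.
have inj : {in `I_(size s) &, injective (nth x0 s)}.
  move=> i j; rewrite !inE /= => si sj /eqP.
  by rewrite nth_uniq// => /eqP.
rewrite -(card_le_eql (inj_card_eq inj)).
by apply: subset_card_le => _ [i si <-]; apply/sA/mem_nth.
Qed.

Section Existence.
Context {R : realType} {G : groupType} {X : metricType R} (act : G -> X -> X).

(** The base point is a parameter because the loxodromic criterion is tested at every point of
    [X]. *)
Definition orbit_dist (o : X) (g h : G) : R := mdist (act g o) (act h o).

Hypothesis hact : is_isometric_action act.

Lemma orbit_pseudodist o : pseudodist (orbit_dist o).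
Proof.
have [D0 Ds Dt] := mdist_pseudodist X; split=> *; [exact: D0|exact: Ds|exact: Dt].
Qed.

Lemma orbit_left_invariant o : left_invariant (orbit_dist o).
Proof.
by case: hact => _ actM acti g x y; rewrite /orbit_dist !actM acti.
Qed.

Lemma orbit_four_point o delta :
  four_point (@mdist R X) delta -> four_point (orbit_dist o) delta.
Proof. by move=> h4 p x y z; exact: h4. Qed.

Hypothesis hunb : unbounded_orbits act.

Lemma orbit_far o (M : R) : exists g, M < orbit_dist o 1%g g.
Proof.
apply: contrapT => noM; apply: (hunb (x := o)); exists (2 * M).
move=> _ _ [g _ <-] [h _ <-].
have le k : orbit_dist o 1%g k <= M.
  by rewrite leNgt; apply/negP => Mk; apply: noM; exists k.
have [_ Ds Dt] := orbit_pseudodist o.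
have := Dt g 1%g h; rewrite (Ds g 1%g) -/(orbit_dist o g h); have := le g; have := le h.
lra.
Qed.

Lemma unbounded_orbits_infinite n : inhabited X ->
  exists s : seq G, uniq s /\ size s = n.
Proof.
case=> o; elim: n => [|n [s [us sn]]]; first by exists [::].
have [M _ sM] := seq_bounded s (orbit_dist o 1%g).
have [g Mg] := orbit_far o M.
exists (g :: s); split; last by rewrite /= sn.
by rewrite /= us andbT; apply/negP => /sM; rewrite leNgt Mg.
Qed.

(* If no element is loxodromic, all orbit directions coincide, so a given finite
   set of elements coarsely fixes far away points of a long geodesic [o, h o]. *)
Lemma loxodromic_exists delta : inhabited X -> geodesic_space X ->
  four_point (@mdist R X) delta -> 0 < delta -> acylindrical act ->
  exists o C k c, loxodromic (orbit_dist o) C k c.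
Proof.
move=> hX hgeo h4 d0 hacy; apply: contrapT => nolox.
have hD := mdist_pseudodist X; have [_ Ds Dt] := hD.
have [act1 actM acti] := hact.
have short x c : mdist x (act c (act c x)) <= mdist x (act c x) + 3 * delta.
  rewrite leNgt; apply/negP => lt; apply: nolox; exists x.
  have [|C [k ck]] := loxodromic_criterion (orbit_pseudodist x)
    (orbit_left_invariant x) (@orbit_four_point x _ h4) d0 (c := c).
    by rewrite /orbit_dist act1 actM.
  by exists C, k, c.
(* If [g] moved [p] far, then [p], [z] and [g z] would lie in one direction from [g p] and [g (g p)]
   in another, so [g] applied twice would nearly double the displacement, against [short]. *)
have align p z g : gromov mdist p z (act g p) <= delta ->
    5 * delta < gromov mdist (act g p) (act g z) z ->
    mdist p (act g p) <= 13 * delta.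
  move=> g1 g2; have sp := short p g.
  have e : gromov mdist (act g p) (act g z) (act g (act g p)) = gromov mdist p z (act g p).
    by rewrite /gromov !acti.
  have e1 := gromov_add hD p (act g p) z.
  rewrite (gromovC hD p _ z) in e1.
  have e2 : mdist (act g p) (act g (act g p)) = mdist p (act g p) by exact: acti.
  have e3 : gromov mdist (act g p) p (act g (act g p)) =
     (mdist (act g p) p + mdist (act g p) (act g (act g p)) - mdist p (act g (act g p))) / 2.
    by [].
  rewrite (Ds (act g p) p) in e3.
  have := h4 (act g p) (act g z) z (act g (act g p)).
  have := h4 (act g p) z p (act g (act g p)).
  rewrite (gromovC hD _ z p).
  by case=> ?; case=> ?; lra.
have [o] := hX.
have [r [N [r0 N0 hN]]] := hacy (13 * delta) ltac:(lra).
have [s [us sN]] := unbounded_orbits_infinite N.+1 hX.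
have [M M0 sM] := seq_bounded s (orbit_dist o 1%g).
(* From [t1] on, [c t] is farther from [o] than [s] moves [o], with the margin that [align] requires
   at [z = o]. *)
pose t1 : R := M + 6 * delta.
have t1E : t1 = M + 6 * delta by [].
have [h hh] := orbit_far o (2 * (t1 + r + M + 9 * delta) + 2 * M).
have [c gc] := hgeo o (act h o).
have lenh : orbit_dist o 1%g h = mdist o (act h o) by rewrite /orbit_dist act1.
clearbody t1.
have key t g : t1 <= t <= t1 + r -> g \in s ->
    mdist (c t) (act g (c t)) <= 13 * delta.
  move=> /andP[tl tr] /sM; rewrite /orbit_dist act1 => gM.
  have [|op ph] := geodesic_point gc (t := t); first lra.
  have p0 : gromov mdist (c t) o (act h o) = 0.
    by rewrite /gromov (Ds (c t) o) op ph; lra.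
  (* Since [c t] lies between [o] and [act h o], its image under [g] points away from one of them,
     which serves as [z]. For [act h o], the alignment of [g * h] with [h] comes from
     [no_loxodromic_gp]. *)
  case: (h4 (c t) o (act g (c t)) (act h o)) => hg.
    apply: (@align _ o); first lra.
    have := gromov_dist_ge hD (act g (c t)) (act g o) o.
    rewrite acti (Ds (c t) o) op (Ds (act g o)); lra.
  apply: (@align _ (act h o)); first by rewrite (gromovC hD); lra.
  have e := gromov_base hD o (act g (c t)) (act g (act h o)) (act h o).
  have tri := Dt o (act g o) (act g (c t)).
  rewrite acti in tri.
  have nl := @no_loxodromic_gp _ _ _ _ (orbit_pseudodist o)
    (orbit_left_invariant o) (@orbit_four_point o _ h4) d0 _ (g * h)%g h.
  have gpE : gromov (orbit_dist o) 1%g (g * h)%g h =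
      gromov mdist o (act g (act h o)) (act h o).
    by rewrite /gromov /orbit_dist act1 actM.
  rewrite gpE in nl.
  have lgh : orbit_dist o 1%g h - M <= orbit_dist o 1%g (g * h)%g.
    rewrite /orbit_dist act1 actM.
    have := Dt (act g o) o (act g (act h o)).
    rewrite acti (Ds _ o); lra.
  have : Num.min (orbit_dist o 1%g (g * h)%g) (orbit_dist o 1%g h)
      <= 2 * gromov mdist o (act g (act h o)) (act h o) + 6 * delta.
    by apply: nl => k; rewrite /orbit_dist act1 actM.
  by rewrite ge_min => /orP[]; lra.
have dpq : mdist (c t1) (c (t1 + r)) = r.
  case: gc => _ _ ->; rewrite ?in_itv/=; [|lra..].
  by rewrite opprD addrA subrr sub0r normrN ger0_norm; lra.
have : (size s <= N)%N.
  apply: (card_le_size (hN (c t1) (c (t1 + r)) _) us); first by rewrite dpq.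
  by move=> g gs; split; apply: key => //; lra.
by rewrite sN ltnn.
Qed.

End Existence.

(** * Fellow-travelling axes *)

Section Axis.
Context {R : realType} {G : groupType} (D : G -> G -> R) (delta : R).

Definition acylindrical_dist : Prop := forall eps : R, 0 < eps ->
  exists (r : R) (N : nat), forall x y : G, r <= D x y ->
    ([set g : G | D x (g * x)%g <= eps /\ D y (g * y)%g <= eps] #<= `I_N)%card.

Hypotheses (hD : pseudodist D) (hinv : left_invariant D).
Hypotheses (h4 : four_point D delta) (delta_gt0 : 0 < delta).
Hypothesis hacy : acylindrical_dist.

Local Notation len := (D 1%g).
Local Notation gp := (gromov D 1%g).

Lemma loxodromic_ge0 C k c : loxodromic D C k c -> 0 <= C.
Proof. by case=> _ /(_ 0 0)%N h _; apply: le_trans h; exact: gromov_ge0. Qed.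

Lemma loxodromicV C k c : loxodromic D C k c -> loxodromic D C k c^-1%g.
Proof.
case=> k0 hC hk; split=> // [i j|n]; last by rewrite expVgn lenV.
by rewrite !expVgn invgK (gromovC hD).
Qed.

Lemma loxodromic_between C k c i m j : loxodromic D C k c -> (i <= m <= j)%N ->
  gromov D (c ^+ m)%g (c ^+ i)%g (c ^+ j)%g <= C.
Proof.
case=> _ hC _ /andP[im mj].
have := hC (m - i)%N (j - m)%N; rewrite -(gromov_left hinv (c ^+ m)%g).
by rewrite mulg1 expgnFr// invgF (mulgA (c ^+ m)%g) -commuteX2// mulgK -expgnDr subnKC.
Qed.

Lemma dist_expg c m l : D (c ^+ m)%g (c ^+ (m + l))%g = len (c ^+ l)%g.
Proof. by rewrite (dist_len hinv) expgnDr mulKg. Qed.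

Lemma first_failure (P : pred nat) j : P 0%N -> ~~ P j ->
  exists2 m, (m < j)%N & P m && ~~ P m.+1.
Proof.
elim: j => [->//|j IHj P0 Pj].
have [Pj'|Pj'] := boolP (P j); first by exists j => //; rewrite Pj'.
by have [m mj Pm] := IHj P0 Pj'; exists m => //; rewrite ltnS ltnW.
Qed.

(** Walk along the powers of [c] to an [m] after which [q] no longer lies ahead. At [c^m] both
    [(1|q)] and [(c^j|q)] are then bounded, the latter with an extra [len c] for one step, so [c^m]
    could be far from [q] only if [(1|c^j)_q] were large. *)
Lemma near_quasigeodesic C k c q j C' : loxodromic D C k c ->
  gromov D q 1%g (c ^+ j)%g <= C' ->
  exists2 m, (m <= j)%N & D q (c ^+ m)%g <= 2 * C + C' + 4 * delta + len c.
Proof.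
move=> lox qj; have C0 := loxodromic_ge0 lox; have d0 := delta_gt0.
have lc := len_ge0 hD c; have [_ Ds _] := hD.
pose far m := C + 2 * delta <= gromov D (c ^+ m)%g (c ^+ j)%g q.
have [f0|f0] := boolP (far 0%N); last first.
  exists 0%N => //; rewrite /far -ltNge expg0 in f0.
  have := gromov_add hD 1%g q (c ^+ j)%g.
  by rewrite (gromovC hD 1%g q) expg0 (Ds q); lra.
have nfj : ~~ far j by rewrite /far -ltNge gromov_zz//; lra.
have [m mj /andP[fm fm1]] := first_failure f0 nfj.
rewrite /far in fm fm1; rewrite -ltNge in fm1.
exists m; first exact: ltnW.
have btw : gromov D (c ^+ m)%g (c ^+ 0)%g (c ^+ j)%g <= C.
  by apply: (loxodromic_between lox); rewrite (ltnW mj).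
rewrite expg0 in btw.
have step := gromov_base hD (c ^+ m)%g (c ^+ m.+1)%g (c ^+ j)%g q.
rewrite -(addn1 m) dist_expg expg1 addn1 in step.
have g1 : gromov D (c ^+ m)%g 1%g q <= C + delta.
  by have := h4 (c ^+ m)%g 1%g q (c ^+ j)%g; rewrite (gromovC hD _ q (c ^+ j)%g); case; lra.
have e1 := gromov_add hD q (c ^+ m)%g 1%g.
have e2 := gromov_add hD q (c ^+ m)%g (c ^+ j)%g.
have := h4 q 1%g (c ^+ m)%g (c ^+ j)%g.
rewrite (gromovC hD q 1%g (c ^+ m)%g).
rewrite (gromovC hD (c ^+ m)%g q 1%g) in e1.
rewrite (gromovC hD (c ^+ m)%g q) in e2.
by case; lra.
Qed.

Section FellowTravel.
Context (C k : R) (c d g : G).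
Hypotheses (lc : loxodromic D C k c) (ld : loxodromic D C k d).
Hypothesis lencd : forall n, len (c ^+ n)%g = len (d ^+ n)%g.

(** [C1] is the bound of [near_quasigeodesic] for [C' = C + 2 * delta]; [C2] bounds the drift after
    equally many further steps on both axes. *)
Let C1 := 3 * C + 6 * delta + len c.
Let C2 := 2 * C + 3 * C1 + 4 * delta.

(** Seen from [d^m], the points [1] and [g] lie on one side and [d^i] and [g c^j] on the other, so
    [d^m] is coarsely between [g] and [g c^j]. *)
Lemma fellow_match i j m : (m <= i)%N -> len g + C + 3 * delta <= len (d ^+ m)%g ->
  len (d ^+ m)%g + C + 3 * delta <= gp (d ^+ i)%g (g * c ^+ j)%g ->
  exists2 n, (n <= j)%N & D (d ^+ m)%g (g * c ^+ n)%g <= C1.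
Proof.
move=> mi h1 h2; have d0 := delta_gt0; have [_ Ds Dt] := hD.
have b : gromov D (d ^+ m)%g (d ^+ 0)%g (d ^+ i)%g <= C.
  by apply: (loxodromic_between ld); rewrite mi.
rewrite expg0 in b.
have b2 := gromov_base hD 1%g (d ^+ m)%g (d ^+ i)%g (g * c ^+ j)%g.
have b3 := gromov_dist_ge hD (d ^+ m)%g 1%g g.
rewrite (Ds (d ^+ m)%g 1%g) in b3.
have b4 : gromov D (d ^+ m)%g g (g * c ^+ j)%g <= C + 2 * delta.
  have := h4 (d ^+ m)%g 1%g g (d ^+ i)%g.
  have := h4 (d ^+ m)%g g (g * c ^+ j)%g (d ^+ i)%g.
  rewrite (gromovC hD (d ^+ m)%g (g * _)%g).
  by case=> ?; case=> ?; lra.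
have b5 : gromov D (g^-1 * d ^+ m)%g 1%g (c ^+ j)%g <= C + 2 * delta.
  by rewrite -(gromov_left hinv g) mulVKg mulg1.
have [n nj hn] := near_quasigeodesic lc b5.
exists n => //; rewrite -(hinv g^-1%g) mulKg /C1; lra.
Qed.

(** Equal lengths of the powers of [c] and [d] keep the two axes in phase: both points lie at about
    the same distance from [d^m] along nearly the same ray. *)
Lemma fellow_shift i j m n l : (m + l <= i)%N -> (n + l <= j)%N ->
  D (d ^+ m)%g (g * c ^+ n)%g <= C1 ->
  len (d ^+ m)%g + len (c ^+ l)%g <= gp (d ^+ i)%g (g * c ^+ j)%g ->
  D (d ^+ (m + l))%g (g * c ^+ (n + l))%g <= C2.
Proof.
move=> mi nj h1 h2; have d0 := delta_gt0; have [_ Ds Dt] := hD.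
have b1 : gromov D (d ^+ (m + l))%g (d ^+ m)%g (d ^+ i)%g <= C.
  by apply: (loxodromic_between ld); rewrite leq_addr.
have b2 : gromov D (c ^+ (n + l))%g (c ^+ n)%g (c ^+ j)%g <= C.
  by apply: (loxodromic_between lc); rewrite leq_addr.
rewrite -(gromov_left hinv g) in b2.
have e1 := gromov_add hD (d ^+ m)%g (d ^+ (m + l))%g (d ^+ i)%g.
have e2 := gromov_add hD (g * c ^+ n)%g (g * c ^+ (n + l))%g (g * c ^+ j)%g.
rewrite hinv !dist_expg in e1 e2; rewrite -lencd in e1.
have b3 := gromov_base hD 1%g (d ^+ m)%g (d ^+ i)%g (g * c ^+ j)%g.
have b4 := gromov_base hD (g * c ^+ n)%g (d ^+ m)%g (g * c ^+ (n + l))%g (g * c ^+ j)%g.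
rewrite (Ds (g * c ^+ n)%g) in b4.
have e3 := dist_gromov D (d ^+ m)%g (d ^+ (m + l))%g (g * c ^+ (n + l))%g.
rewrite dist_expg -lencd in e3.
have t1 := Dt (d ^+ m)%g (g * c ^+ n)%g (g * c ^+ (n + l))%g.
rewrite hinv dist_expg in t1.
have D0 := dist_ge0 hD (d ^+ m)%g (g * c ^+ n)%g.
have C0 := loxodromic_ge0 lc.
rewrite /C2; move: C1 h1 => K h1.
have := h4 (d ^+ m)%g (d ^+ (m + l))%g (d ^+ i)%g (g * c ^+ (n + l))%g.
have := h4 (d ^+ m)%g (d ^+ i)%g (g * c ^+ j)%g (g * c ^+ (n + l))%g.
rewrite (gromovC hD (d ^+ m)%g (g * c ^+ j)%g).
by case=> ?; case=> ?; lra.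
Qed.

(** The factor [d^-l] goes back to [d^m], hence near [g c^n], and [g c^l g^-1] advances from there
    to near [g c^(n+l)]. *)
Lemma fellow_commutator i j m n l : (m + l <= i)%N -> (n + l <= j)%N ->
  D (d ^+ m)%g (g * c ^+ n)%g <= C1 ->
  len (d ^+ m)%g + len (c ^+ l)%g <= gp (d ^+ i)%g (g * c ^+ j)%g ->
  D (d ^+ (m + l))%g (g * c ^+ l * g^-1 * d ^- l * d ^+ (m + l))%g <= C1 + C2.
Proof.
move=> mi nj h1 h2; have [_ Ds Dt] := hD.
have := Dt (d ^+ (m + l))%g (g * c ^+ (n + l))%g
  (g * c ^+ l * g^-1 * d ^- l * d ^+ (m + l))%g.
have := fellow_shift mi nj h1 h2.
rewrite (addnC n) (addnC m) !expgnDr !mulgA -(mulgA _ (d ^- l)%g) mulVg mulg1.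
rewrite -(mulgA _ g^-1%g) hinv -(hinv g (c ^+ n)%g) mulVKg.
rewrite (Ds (g * c ^+ n)%g); lra.
Qed.

End FellowTravel.

(** If the axes overlap for long, the elements [g c^l g^-1 d^-l] with [l <= N] coarsely fix two far
    apart points. Acylindricity makes two of them coincide, which is a relation between powers. The
    bound on [n] is uniform in [g], so that one power of [c] can serve all [g]. *)
Lemma fellow_power C k c d : loxodromic D C k c -> loxodromic D C k d ->
  (forall n, len (c ^+ n)%g = len (d ^+ n)%g) ->
  exists2 N, (0 < N)%N & forall g,
    (exists B, forall i j, gp (d ^+ i)%g (g * c ^+ j)%g <= B) \/
    (exists2 n, (0 < n <= N)%N & (g * c ^+ n = d ^+ n * g)%g).
Proof.
move=> lc ld lencd.
have C0 := loxodromic_ge0 lc; have d0 := delta_gt0.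
have lc0 := len_ge0 hD c.
set C1 : R := 3 * C + 6 * delta + len c.
set C2 : R := 2 * C + 3 * C1 + 4 * delta.
have C12 : 0 < C1 + C2 by rewrite /C2 /C1; lra.
have [r [N hN]] := hacy C12.
have k0 : 0 < k by case: lc.
have arch (x : R) : exists n : nat, x <= n%:R * k.
  exists (Num.bound `|x / k|); rewrite -ler_pdivrMr//.
  by apply: le_trans (ler_norm _) _; apply/ltW/archi_boundP.
exists N.+1 => // g.
(* [M0] steps lead beyond [g], [N] steps leave room for the shifts by [l], and [M1] steps separate
   the two test points by [r]. *)
have [M0 hM0] := arch (len g + C + 3 * delta).
have [M1 hM1] := arch r.
pose Q := (M0 + N + M1)%N%:R * len c.
have Qm m : (m <= M0 + N + M1)%N -> len (d ^+ m)%g <= Q.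
  move=> mM; rewrite -lencd; apply: le_trans (lenX hD hinv c m) _.
  by rewrite ler_wpM2r// ler_nat.
pose T := 2 * Q + len g + C1 + C + 4 * delta.
have [[i [j ij]]|nfar] := pselect (exists i j, T < gp (d ^+ i)%g (g * c ^+ j)%g); last first.
  left; exists T => i j; rewrite leNgt; apply/negP => lt.
  by apply: nfar; exists i, j.
right.
have iM : (M0 + N + M1 <= i)%N.
  rewrite leqNgt; apply/negP => /ltnW /Qm.
  have := gromov_lel hD 1%g (d ^+ i)%g (g * c ^+ j)%g.
  have := len_ge0 hD g; have := len_ge0 hD (d ^+ i)%g.
  by move: ij; rewrite /T /C1; lra.
have close m l : (M0 <= m)%N -> (m + l <= M0 + N + M1)%N -> (l <= N)%N ->
    D (d ^+ (m + l))%g (g * c ^+ l * g^-1 * d ^- l * d ^+ (m + l))%g <= C1 + C2.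
  move=> Mm mlM lN.
  have mM : (m <= M0 + N + M1)%N by apply: leq_trans mlM; rewrite leq_addr.
  have lM : (l <= M0 + N + M1)%N by apply: leq_trans mlM; rewrite leq_addl.
  have h1 : len g + C + 3 * delta <= len (d ^+ m)%g.
    case: ld => _ _ /(_ m); apply: le_trans; apply: le_trans hM0 _.
    by rewrite ler_wpM2r ?ler_nat// ltW.
  have g0 := len_ge0 hD g; have qm := Qm _ mM; have ql := Qm _ lM.
  have q0 := le_trans (len_ge0 hD (d ^+ m)%g) qm.
  have C10 : 0 <= C1 by rewrite /C1; lra.
  have [|||n nj hn] := @fellow_match C k c d g lc ld i j m.
  - exact: leq_trans mM iM.
  - exact: h1.
  - by move: ij; rewrite /T; lra.
  apply: (@fellow_commutator C k c d g lc ld lencd i j m n l _ _ hn).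
  - exact: leq_trans mlM iM.
  - rewrite leqNgt; apply/negP => jnl.
    have jn : (j - n <= M0 + N + M1)%N by apply: leq_trans lM; rewrite leq_subLR ltnW.
    have [_ Ds Dt] := hD.
    have := Qm _ jn; rewrite -lencd -(dist_expg c n) subnKC// -(hinv g).
    have := Dt 1%g (d ^+ m)%g (g * c ^+ n)%g.
    have := Dt 1%g (g * c ^+ n)%g (g * c ^+ j)%g.
    have := gromov_ler hD 1%g (d ^+ i)%g (g * c ^+ j)%g.
    by move: ij hn; rewrite /T -/C1; lra.
  - by move: ij; rewrite lencd /T; lra.
pose v l := (g * c ^+ l * g^-1 * d ^- l)%g.
have [l1 [l2 [l12 l2N ve]]] : exists l1 l2, [/\ (l1 < l2)%N, (l2 <= N)%N & v l1 = v l2].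
  apply: contrapT => nov.
  have vinj : {in iota 0 N.+1 &, injective v}.
    move=> l l'; rewrite !mem_iota !add0n !ltnS => /andP[_ lN] /andP[_ lN'] e.
    case: (ltngtP l l') => // ll'; exfalso; apply: nov.
      by exists l, l'.
    by exists l', l; split=> //.
  have us : uniq (map v (iota 0 N.+1)) by rewrite map_inj_in_uniq ?iota_uniq.
  have : (size (map v (iota 0 N.+1)) <= N)%N.
    apply: (card_le_size (hN (d ^+ (M0 + N))%g (d ^+ (M0 + N + M1))%g _) us).
      by rewrite dist_expg; case: ld => _ _ /(_ M1); apply: le_trans.
    move=> _ /mapP[l + ->]; rewrite mem_iota add0n ltnS => /andP[_ lN]; split.
      (* Starting [l] steps earlier makes the moved point [d^(M0 + N)] independent of [l]. *)
      have := close (M0 + (N - l))%N l.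
      have -> : (M0 + (N - l) + l = M0 + N)%N by lia.
      by apply => //; lia.
    have := close (M0 + (N - l) + M1)%N l.
    have -> : (M0 + (N - l) + M1 + l = M0 + N + M1)%N by lia.
    by apply => //; lia.
  by rewrite size_map size_iota ltnn.
exists (l2 - l1)%N; first by rewrite subn_gt0 l12 (leq_trans (leq_subr _ _))// ltnW.
have c12 : (c ^+ l2 = c ^+ l1 * c ^+ (l2 - l1))%g by rewrite -expgnDr subnKC// ltnW.
have d12 : (d ^- l2 = d ^- (l2 - l1) * d ^- l1)%g by rewrite -invgM -expgnDr subnKC// ltnW.
move: ve; rewrite /v c12 d12 !mulgA => /mulIg.
move: (l2 - l1)%N (c ^+ l1)%g => n x.
move=> /(congr1 (fun y => (g * x)^-1 * (y * d ^+ n * g))%g).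
by rewrite !mulgVK mulKg -!(mulgA (g * x)%g) mulKg => <-; rewrite !mulgA mulgV mul1g.
Qed.

End Axis.

(** * The stabilizer of an axis *)

Definition signed {G : groupType} (b : bool) (a : G) : G := if b then a else a^-1%g.

(* For a loxodromic element of an acylindrical action whose powers have no larger
   centralizers, this is the stabilizer of its pair of limit points. *)
Definition signed_centralizer {G : groupType} (a : G) : set G :=
  [set g | exists b, (g * a = signed b a * g)%g].

Section SignedPowers.
Context {G : groupType}.
Implicit Types a g x y : G.

Lemma signedN b a : signed (~~ b) a = (signed b a)^-1%g.
Proof. by case: b => //=; rewrite invgK. Qed.

Lemma intertwineX g x y n : (g * x = y * g -> g * x ^+ n = y ^+ n * g)%g.
Proof.
move=> e; elim: n => [|n IHn]; first by rewrite mulg1 mul1g.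
by rewrite !expgS mulgA e -mulgA IHn mulgA.
Qed.

Lemma intertwineV g x y : (g * x = y * g -> g * x^-1 = y^-1 * g)%g.
Proof. by move=> e; apply: (@mulgI _ y); rewrite mulVKg mulgA -e mulgK. Qed.

Lemma intertwineVl g x y : (g * x = y * g -> g^-1 * y = x * g^-1)%g.
Proof. by move=> e; apply: (@mulgI _ g); rewrite mulVKg mulgA e mulgK. Qed.

Lemma intertwineM g h x y z :
  (g * x = y * g -> h * z = x * h -> (g * h) * z = y * (g * h))%g.
Proof. by move=> e f; rewrite -mulgA f !mulgA e. Qed.

Lemma signedX b a n : signed b (a ^+ n)%g = (signed b a ^+ n)%g.
Proof. by case: b => //=; rewrite expVgn. Qed.

Lemma signed_centralizerP a g b : signed_centralizer a g ->
  exists b', (g * signed b a = signed b' a * g)%g.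
Proof.
case=> b' e; case: b => /=; first by exists b'.
by exists (~~ b'); rewrite signedN; exact: intertwineV.
Qed.

Lemma signed_centralizerM a g h : signed_centralizer a g ->
  signed_centralizer a h -> signed_centralizer a (g * h)%g.
Proof.
move=> Eg [b hb]; have [b' gb'] := signed_centralizerP b Eg.
by exists b'; exact: intertwineM gb' hb.
Qed.

Lemma signed_centralizerV a g : signed_centralizer a g ->
  signed_centralizer a g^-1%g.
Proof.
move=> [b /= gb]; exists b; move: gb; case: b => /= gb.
  exact: intertwineVl.
by have := intertwineVl (intertwineV gb); rewrite invgK.
Qed.

End SignedPowers.

Section WPD.
Context {R : realType} {G : groupType} (D : G -> G -> R) (delta : R).
Hypotheses (hD : pseudodist D) (hinv : left_invariant D).
Hypotheses (h4 : four_point D delta) (delta_gt0 : 0 < delta).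
Hypothesis hacy : acylindrical_dist D.

Local Notation len := (D 1%g).
Local Notation gp := (gromov D 1%g).

(** An element taking the attracting point of [signed b' a] to that of [signed b a] must intertwine
    the two exactly, not only up to powers. *)
Definition separated_axes (a : G) : Prop := forall b b' g,
  (g * signed b' a)%g <> (signed b a * g)%g ->
  exists B, forall i j, gp (signed b a ^+ i)%g (g * signed b' a ^+ j)%g <= B.

(** [fellow_power] intertwines [n]th powers for some [n <= S], with [S] independent of [g]; every
    such [n] divides the exponent [S!]. *)
Lemma separated_axes_exists C k c : loxodromic D C k c ->
  exists a, loxodromic D C k a /\ separated_axes a.
Proof.
move=> lc.
have ls b : loxodromic D C k (signed b c).
  by case: b => //; exact: loxodromicV.
have lens b n : len (signed b c ^+ n)%g = len (c ^+ n)%g.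
  by case: b => //=; rewrite expVgn lenV.
have fp b b' : exists2 N, (0 < N)%N & forall g,
    (exists B, forall i j, gp (signed b c ^+ i)%g (g * signed b' c ^+ j)%g <= B) \/
    (exists2 n, (0 < n <= N)%N &
      (g * signed b' c ^+ n = signed b c ^+ n * g)%g).
  by apply: fellow_power (ls b') (ls b) _ => // n; rewrite !lens.
have [S hS] : exists S, forall b b' g,
    (exists B, forall i j, gp (signed b c ^+ i)%g (g * signed b' c ^+ j)%g <= B) \/
    (exists2 n, (0 < n <= S)%N &
      (g * signed b' c ^+ n = signed b c ^+ n * g)%g).
  have [N1 _ h1] := fp true true; have [N2 _ h2] := fp true false.
  have [N3 _ h3] := fp false true; have [N4 _ h4'] := fp false false.
  exists (N1 + N2 + N3 + N4)%N => b b' g.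
  have aux N : (N <= N1 + N2 + N3 + N4)%N ->
      (exists2 n, (0 < n <= N)%N & (g * signed b' c ^+ n = signed b c ^+ n * g)%g) ->
      exists2 n, (0 < n <= N1 + N2 + N3 + N4)%N &
        (g * signed b' c ^+ n = signed b c ^+ n * g)%g.
    by move=> le [n /andP[n0 nN] e]; exists n => //; rewrite n0 (leq_trans nN).
  case: b b' aux => -[] aux.
  - by case: (h1 g) => [?|/aux h]; [left|right; apply: h; lia].
  - by case: (h2 g) => [?|/aux h]; [left|right; apply: h; lia].
  - by case: (h3 g) => [?|/aux h]; [left|right; apply: h; lia].
  - by case: (h4' g) => [?|/aux h]; [left|right; apply: h; lia].
exists (c ^+ S`!)%g; split.
  case: lc => k0 hC hk; split=> // [i j|n]; first by rewrite -!expgnA.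
  rewrite -expgnA; apply: le_trans (hk _).
  by rewrite ler_wpM2r ?ler_nat ?leq_pmull ?fact_gt0// ltW.
move=> b b' g; rewrite !signedX => ne.
case: (hS b b' g) => [[B hB]|[n /andP[n0 nS] e]].
  by exists B => i j; rewrite -!expgnA.
exfalso; apply: ne.
have /dvdnP[q ->] : (n %| S`!)%N by apply: dvdn_fact; rewrite n0.
by rewrite mulnC !expgnA; exact: intertwineX.
Qed.

Context (C k : R) (a : G).
Hypotheses (la : loxodromic D C k a) (sa : separated_axes a).

Lemma len_expg_large (x : R) : exists n, forall m, (n <= m)%N -> x <= len (a ^+ m)%g.
Proof.
case: la => k0 _ hk; exists (Num.bound `|x / k|) => m nm.
apply: le_trans (hk _); rewrite -ler_pdivrMr//.
apply: le_trans (ler_norm _) _; apply/ltW.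
by apply: lt_le_trans (archi_boundP _) _; rewrite ?ler_nat.
Qed.

(** If [g] commutes with [a^n], then [g a^(n m)] stays within [len g] of [a^(n m)] for all [m], so
    the Gromov products are unbounded. *)
Lemma commute_expgI g n : (0 < n)%N -> commute g (a ^+ n)%g -> commute g a.
Proof.
move=> n0 gn; apply: contrapT => nga.
have [B hB] := sa (b := true) (b' := true) nga.
have [m hm] := len_expg_large (B + len g + 1).
have := hB (n * m)%N (n * m)%N; rewrite /=.
have -> : (g * a ^+ (n * m) = a ^+ (n * m) * g)%g.
  by rewrite expgnA; exact: commuteX.
rewrite gp_mul//.
have := gromov_ler hD 1%g (a ^- (n * m))%g g.
have := hm (n * m)%N (leq_pmull _ n0); lra.
Qed.

(** An element commuting with [a] displaces [1] and [a^n] equally, so acylindricity applies to these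
    two points. *)
Lemma commute_small_finite (K : R) :
  exists s : seq G, forall g, commute g a -> len g <= K -> g \in s.
Proof.
have K0 : 0 < Num.max K 1 by rewrite lt_max ltr01 orbT.
have [r [N hN]] := hacy K0.
have [n hn] := len_expg_large r.
have /finite_seqP[s hs] : finite_set [set g | D 1%g (g * 1)%g <= Num.max K 1 /\
    D (a ^+ n)%g (g * a ^+ n)%g <= Num.max K 1].
  by apply/finite_set_leP; exists N; apply: hN; exact: hn.
exists s => g ga gK; suff : [set` s] g by [].
rewrite -hs /= mulg1 (commuteX n ga).
by rewrite (dist_len hinv (a ^+ n)%g) mulKg !le_max gK.
Qed.

(** Such a [g] commutes with [a] and [t a t^-1], so it coarsely fixes the limits of [a^n], [a^-n]
    and [t a^n]. They are distinct, with [1] as a coarse center of their tripod; hence [g] moves [1]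
    by a bounded amount. *)
Lemma centralizer_meet_finite t : ~ signed_centralizer a t ->
  exists s : seq G, forall g, commute g a -> commute (g ^ t)%g a -> g \in s.
Proof.
move=> nt; have d0 := delta_gt0; have dge0 := ltW d0.
have sep b : exists B, forall i j, gp (signed b a ^+ i)%g (t * a ^+ j)%g <= B.
  by apply: (sa (b' := true)) => e; apply: nt; exists b.
have [B1 hB1] := sep true; have [B2 hB2] := sep false.
have lC : forall i j, gp (a ^- i)%g (a ^+ j)%g <= C by case: la.
pose K := Num.max C (Num.max B1 B2).
have [s hs] := commute_small_finite (2 * K + 5 * delta).
exists s => g ga gta; apply: hs => //.
have [_ Ds Dt] := hD.
pose r := len g + len (g ^ t)%g.
(* [n] depends on [g], but the bound [2 * K + 5 * delta] from [coarse_center_dist] does not. *)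
have [n hn] := len_expg_large (r + 2 * len g + K + 5 * delta + len t).
have ln := hn n (leqnn n); rewrite /r in ln.
have g0 := len_ge0 hD g; have gt0 := len_ge0 hD (g ^ t)%g; have t0 := len_ge0 hD t.
have gan := commuteX n ga; have gtan := commuteX n gta.
apply: (@coarse_center_dist _ _ _ hD delta K r 1%g g
  (a ^+ n)%g (a ^- n)%g (t * a ^+ n)%g
  (g * a ^+ n)%g (g * a ^- n)%g (g * (t * a ^+ n))%g) => //.
- by rewrite (gromovC hD); apply: le_trans (lC _ _) _; rewrite le_max lexx.
- by apply: le_trans (hB1 _ _) _; rewrite !le_max lexx !orbT.
- by rewrite -expVgn; apply: le_trans (hB2 _ _) _; rewrite !le_max lexx !orbT.
- rewrite -{1}(mulg1 g) gromov_left// (gromovC hD).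
  by apply: le_trans (lC _ _) _; rewrite le_max lexx.
- rewrite -{1}(mulg1 g) gromov_left//.
  by apply: le_trans (hB1 _ _) _; rewrite !le_max lexx !orbT.
- rewrite -{1}(mulg1 g) gromov_left// -expVgn.
  by apply: le_trans (hB2 _ _) _; rewrite !le_max lexx !orbT.
- by rewrite gan (dist_len hinv) mulKg /r; lra.
- by rewrite (commuteV gan) (dist_len hinv) mulKg /r; lra.
- have -> : (g * (t * a ^+ n) = t * a ^+ n * g ^ t)%g.
    by rewrite -(mulgA t) -gtan conjgE !mulgA mulgV mul1g.
  by rewrite (dist_len hinv) mulKg /r; lra.
- by rewrite /r; lra.
- by rewrite lenV// /r; lra.
- have := lenM hD hinv t^-1%g (t * a ^+ n)%g.
  by rewrite mulKg lenV// /r; lra.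
Qed.

(** The centralizer coarsely preserves the axis: for large [J] the point [g a^J] is close to some
    [a^m], so [f = a^-m g a^J] is short. The product [a ^+ i * a ^- j] encodes an integer power. *)
Lemma centralizer_cosets : exists s : seq G, forall g, commute g a ->
  exists2 f, f \in s & exists i j, (g = f * a ^+ i * a ^- j)%g.
Proof.
have d0 := delta_gt0.
have [s hs] := commute_small_finite (2 * C + (C + 2 * delta) + 4 * delta + len a).
exists s => g ga; have [_ Ds Dt] := hD.
have [J hJ] := len_expg_large (len g + C + 3 * delta).
have lJ := hJ J (leqnn J).
have C0 := loxodromic_ge0 hD la.
set q := (g * a ^+ J)%g.
have b1 : gromov D q g (g * a ^+ (J + J))%g <= C.
  rewrite /q -{2}(mulg1 g) gromov_left// -(expg0 a).
  by apply: (loxodromic_between hinv la); rewrite leq_addr.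
have b2 : len (a ^+ J)%g - len g <= gromov D q g 1%g.
  have := gromov_dist_ge hD q g 1%g; rewrite /q (Ds _ g) (Ds g 1%g).
  by rewrite (dist_len hinv g) mulKg.
have b3 : len (a ^+ J)%g - len g <=
    gromov D q (g * a ^+ (J + J))%g (a ^+ (J + J))%g.
  have := gromov_dist_ge hD q (g * a ^+ (J + J))%g (a ^+ (J + J))%g.
  rewrite /q hinv dist_expg// (Ds _ (a ^+ (J + J))%g) (commuteX (J + J) ga).
  by rewrite (dist_len hinv (a ^+ _)%g) mulKg.
have b4 : gromov D q 1%g (a ^+ (J + J))%g <= C + 2 * delta.
  have := h4 q g 1%g (g * a ^+ (J + J))%g.
  have := h4 q 1%g (a ^+ (J + J))%g (g * a ^+ (J + J))%g.
  rewrite (gromovC hD q (a ^+ _)%g); case=> ?; case=> ?; lra.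
have [m _ hm] := near_quasigeodesic hD hinv h4 d0 la b4.
exists (a ^- m * q)%g; last first.
  exists m, J; rewrite /q (commuteX J ga).
  have e : commute (a ^+ m) (a ^+ J) by exact: commuteX2.
  rewrite mulgA -(mulgA _ g) (commuteX m ga) !mulgA.
  by rewrite -(mulgA _ (a ^+ J)%g) -e mulgA mulVg mul1g -(commuteX J ga) mulgK.
apply: hs; last by rewrite -(dist_len hinv) Ds.
apply: commute_sym; apply: commuteM; last by apply: commuteM; [exact: commute_sym|exact: commuteX].
exact/commuteV/commuteX.
Qed.

Lemma finitely_many_cosets_virtually_cyclic (s : seq G) :
  (forall x, exists2 t, t \in s & signed_centralizer a (t^-1 * x)%g) ->
  virtually_cyclic G.
Proof.
move=> hs; have [fs hfs] := centralizer_cosets.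
(* [e0] inverts [a] if some element does, and is [1] otherwise: the centralizer has index at most
   two in its signed version. *)
have [e0 he0] : exists e0, forall g, signed_centralizer a g ->
    commute g a \/ commute (e0^-1 * g)%g a.
  have [[e [b he]]|none] := pselect (exists e, exists b, (e * a = signed b a * e)%g /\ b = false).
    case: he => he bF; rewrite bF /= in he.
    exists e => g [[]/= hg]; [by left|right].
    exact: intertwineM (intertwineVl he) hg.
  exists 1%g => g [[]/= hg]; first by left.
  by exfalso; apply: none; exists g, false.
have cycM i j h : cyclic_subgroup a h ->
    cyclic_subgroup a (a ^+ i * a ^- j * h)%g.
  have key n m : cyclic_subgroup a (a ^+ n * a ^- m)%g.
    have [mn|/ltnW nm] := leqP m n.
      by exists (n - m)%N; left; rewrite expgnFr.
    by exists (m - n)%N; right; rewrite expgnFr// invgF.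
  case=> n [] ->.
    rewrite -mulgA -(commuteV (commuteX2 n j (commute_refl a))) mulgA -expgnDr.
    exact: key.
  by rewrite -mulgA -invgM -expgnDr; exact: key.
exists a; rewrite /finite_index.
pose L := [seq (te * f)%g | te <- [seq (t * e)%g | t <- s, e <- [:: 1%g; e0]], f <- fs].
apply: (@sub_finite_set _ _ [set` map (fun g => [set (g * h)%g | h in cyclic_subgroup a]) L]); last first.
  exact: finite_seq.
move=> _ [x _ <-] /=.
have [t ts /he0 tx] := hs x.
have [e [es /hfs[f fs' [i [j fE]]]]] : exists e, e \in [:: 1%g; e0] /\ commute (e^-1 * (t^-1 * x))%g a.
  case: tx => h; [exists 1%g|exists e0]; rewrite !inE eqxx ?orbT; split=> //.
  by rewrite invg1 mul1g.
have xE : x = (t * e * f * (a ^+ i * a ^- j))%g.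
  by rewrite -(mulgA _ f) (mulgA f) -fE !mulgA mulgK mulgV mul1g.
apply/mapP; exists (t * e * f)%g.
  by apply/allpairsP; exists ((t * e)%g, f); split=> //; apply/allpairsP; exists (t, e).
apply/seteqP; split=> [_ [h ch <-]|_ [h ch <-]].
  by exists (a ^+ i * a ^- j * h)%g; [exact: cycM|rewrite xE !mulgA].
exists (a ^+ j * a ^- i * h)%g; first exact: cycM.
by rewrite xE !mulgA mulgVK mulgK.
Qed.
End WPD.

(** * Points in general position *)

Lemma pigeonhole_nat (T : eqType) (F : nat -> T) (s : seq T) (n : nat) :
  (forall i, (i < n)%N -> F i \in s) -> (size s < n)%N ->
  exists i j, (i < j < n)%N /\ F i = F j.
Proof.
move=> Fs sn; have : ~~ uniq (mkseq F n).
  apply/negP => /uniq_leq_size h; have := h s; rewrite size_mkseq leqNgt sn.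
  by move=> /(_ _)/negP; apply => // _ /mapP[i + ->]; rewrite mem_iota add0n; exact: Fs.
move=> /(uniqPn (F 0%N))[i [j []]]; rewrite size_mkseq => ij jn.
rewrite !nth_mkseq//; last exact: ltn_trans jn.
by exists i, j; rewrite ij.
Qed.

(** * Coset coverings *)

Section Cosets.
Context {G : groupType}.
Implicit Types (H : set G) (r : seq G).

Definition divg_closed_set H : Prop := forall x y, H x -> H y -> H (x * y^-1)%g.

Definition infinite_index H : Prop :=
  forall r, exists x, forall t, t \in r -> ~ H (t^-1 * x)%g.

(* B. H. Neumann's lemma. *)
Lemma cosets_not_cover (I : eqType) (s : seq I) (H : I -> set G) (r : I -> seq G) :
  (forall i, i \in s -> divg_closed_set (H i) /\ infinite_index (H i)) ->
  exists x, forall i, i \in s -> forall t, t \in r i -> ~ H i (t^-1 * x)%g.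
Proof.
elim: s r => [|k s IHs] r hH; first by exists 1%g.
have [Hdiv Hinf] := hH k (mem_head _ _).
have [g hg] := Hinf (r k).
(* The coset of [g] is not on the list [r k], so a point of the coset of [t] can be moved there by
   [g t^-1]; the extra cosets keep the moved point off the other lists. *)
pose r' i := r i ++ [seq (t * g^-1 * t')%g | t <- r k, t' <- r i].
have [i si|x hx] := IHs r'; first by apply: hH; rewrite inE si orbT.
have [[t tk Ht]|nk] := pselect (exists2 t, t \in r k & H k (t^-1 * x)%g); last first.
  exists x => i; rewrite inE => /predU1P[-> t tk Ht|si t ti].
    by apply: nk; exists t.
  by apply: hx => //; rewrite mem_cat ti.
exists (g * t^-1 * x)%g => i; rewrite inE => /predU1P[-> t' tk' Ht'|si t' ti'].
  apply: (hg t' tk'); have := Hdiv _ _ Ht' Ht.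
  by rewrite invgM invgK !mulgA mulgK mulgVK.
have -> : (t'^-1 * (g * t^-1 * x) = (t * g^-1 * t')^-1 * x)%g.
  by rewrite !invgM invgK !mulgA.
apply: hx => //; rewrite mem_cat; apply/orP; right.
by apply/allpairsP; exists (t, t').
Qed.

Lemma infinite_index_conj H y : infinite_index H ->
  infinite_index [set g | H (g ^ y)%g].
Proof.
move=> hH r; have [x hx] := hH [seq (t * y)%g | t <- r].
exists (x * y^-1)%g => t tr /= Hx; apply: (hx _ (map_f (fun u => u * y)%g tr)).
by move: Hx; rewrite conjgE invgM !mulgA mulgVK.
Qed.

Lemma greedy_family (P : G -> Prop) (Q : G -> G -> Prop) n :
  (forall r, exists x, P x /\ forall y, y \in r -> Q y x) ->
  exists e : nat -> G, (forall i, (i < n)%N -> P (e i)) /\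
    forall i j, (i < j < n)%N -> Q (e i) (e j).
Proof.
move=> h; elim: n => [|n [e [eP eQ]]].
  by exists (fun=> 1%g); split=> // i j; rewrite ltn0 andbF.
have [x [Px Qx]] := h (mkseq e n).
exists (fun i => if i == n then x else e i); split=> [i|i j /andP[ij]].
  by rewrite ltnS leq_eqVlt; case: eqP => //= _; exact: eP.
rewrite ltnS leq_eqVlt => /predU1P[jn|jn].
  subst j; rewrite eqxx (ltn_eqF ij); apply: Qx.
  by apply: map_f; rewrite mem_iota.
by rewrite !ltn_eqF ?(ltn_trans ij)//; apply: eQ; rewrite ij.
Qed.

End Cosets.

(** * Consequences of a trivial finite radical *)

Section TrivialRadical.
Context {G : groupType} (a : G).
Hypothesis comm_expgI : forall g n, (0 < n)%N -> commute g (a ^+ n)%g -> commute g a.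
Hypothesis centralizer_meet : forall t, ~ signed_centralizer a t ->
  exists s : seq G, forall g, commute g a -> commute (g ^ t)%g a -> g \in s.
Hypothesis stab_infinite : infinite_index (signed_centralizer a).
Hypothesis hK : is_finite_radical [set 1%g : G].

(** The elements with finite conjugacy class form a normal subgroup [K]. By the pigeonhole principle
    each commutes with a power of [a], hence with [a]. Normality puts [K] into a finite intersection
    of two centralizers, and triviality of the radical applies. *)
Lemma finite_class_trivial (f : G) (s : seq G) :
  (forall x, (f ^ x)%g \in s) -> f = 1%g.
Proof.
move=> hs; pose K : set G := [set h | exists r : seq G, forall x, (h ^ x)%g \in r].
have KJ h y : K h -> K (h ^ y)%g.
  by case=> r hr; exists r => x; rewrite -conjgM.
have Kn : is_normal_subgroup K.
  split; last by move=> h y; exact: KJ.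
  split; first by rewrite inE; exists [:: 1%g] => x; rewrite conj1g inE.
  move=> x y; rewrite !inE => -[r hr] [r' hr'].
  exists [seq (u * v^-1)%g | u <- r, v <- r'] => z.
  by apply/allpairsP; exists (x ^ z, y ^ z)%g; rewrite conjMg conjVg hr hr'.
have Ka h : K h -> commute h a.
  case=> r hr; have [i [j [/andP[ij _] e]]] :=
    @pigeonhole_nat _ (fun i => h ^ (a ^+ i))%g r (size r).+1 (fun i _ => hr _) (ltnSn _).
  apply: (@comm_expgI _ (j - i)%N); first by rewrite subn_gt0.
  have aj : (a ^+ j = a ^+ (j - i) * a ^+ i)%g by rewrite -expgnDr subnK// ltnW.
  by move: e; rewrite aj conjgM => /conjg_inj/esym/conjg_fixP/commgP.
have [t ht] := stab_infinite [:: 1%g].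
have {}ht : ~ signed_centralizer a t.
  by have := ht 1%g (mem_head _ _); rewrite invg1 mul1g.
have [r hr] := centralizer_meet ht.
have Kf : finite_set K.
  apply: (sub_finite_set _ (finite_seq r)) => h Kh /=.
  by apply: hr; apply: Ka => //; exact: KJ.
have : K f by exists s.
case: hK => _ _ /(_ K Kn Kf) ->//.
by move=> _ ->; exists [:: 1%g] => x; rewrite conj1g inE.
Qed.

Lemma centralizer_infinite_index (f : G) : f <> 1%g ->
  infinite_index [set g | commute g f].
Proof.
move=> f1 r; apply: contrapT => nx; apply: f1.
apply: (@finite_class_trivial f [seq (f ^ t^-1)%g | t <- r]) => x.
have [t tr xt] : exists2 t, t \in r & commute (t^-1 * x^-1)%g f.
  apply: contrapT => nt; apply: nx; exists x^-1%g => t tr tx.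
  by apply: nt; exists t.
apply/mapP; exists t => //.
have /commgP/conjg_fixP fh := commuteV (commute_sym xt).
by rewrite -{2}fh -conjgM invgM !invgK mulgK.
Qed.

(* Two distinct translates of [a] have only finitely many common centralizing
   elements, so each [s] is bad for at most one translate of a generic [x]. *)
Lemma avoid_stabilizers (S T : seq G) : exists z,
  (forall s, s \in S -> s <> 1%g -> ~ commute (s ^ z)%g a) /\
  (forall t, t \in T -> ~ signed_centralizer a (t^-1 * z)%g).
Proof.
(* One translate more than elements of [S]: if all translates are bad, two of them are bad for the
   same [s]. *)
pose m := (size S).+1.
have [tau [_ htau]] := @greedy_family G (fun=> True)
  (fun y x => ~ signed_centralizer a (y^-1 * x)%g) m
  (fun r => let: ex_intro x hx := stab_infinite r in ex_intro _ x (conj I hx)).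
have [F hF] : exists F : seq G, forall i j, (i < j < m)%N -> forall y,
    commute (y ^ tau i)%g a -> commute (y ^ tau j)%g a -> y \in F.
  have /choice[F hF] : forall ij : nat * nat, exists s : seq G,
      (ij.1 < ij.2 < m)%N -> forall y,
      commute (y ^ tau ij.1)%g a -> commute (y ^ tau ij.2)%g a -> y \in s.
    move=> [i j] /=; have [ijm|] := boolP (i < j < m)%N; last by exists [::].
    have [s hs] := centralizer_meet (htau _ _ ijm).
    exists [seq (g ^ (tau i)^-1)%g | g <- s] => _ y yi yj.
    apply/mapP; exists (y ^ tau i)%g; last by rewrite conjgK.
    by apply: hs => //; rewrite -conjgM mulVKg.
  exists (flatten [seq F (i, j) | i <- iota 0 m, j <- iota 0 m]) => i j ijm y yi yj.
  apply/flattenP; exists (F (i, j)); last exact: (hF (i, j)).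
  by apply/allpairsP; exists (i, j); rewrite !mem_iota /=; split=> //; lia.
(* The solutions [y] of [s ^ y = f], if any, form the left coset of the centralizer of [f]
   represented by [x0]. *)
have /choice[x0 hx0] : forall sf : G * G, exists x, forall y,
    (sf.1 ^ y)%g = sf.2 -> (sf.1 ^ x)%g = sf.2.
  move=> [s f] /=; have [[x hx]|nx] := pselect (exists x, (s ^ x)%g = f).
    by exists x.
  by exists 1%g => y hy; exfalso; apply: nx; exists y.
(* Indices [inl i] keep [x * tau i] out of the cosets given by [T]; indices [inr f] keep [s ^ x]
   away from the nontrivial [f] in [F]. *)
pose H (i : nat + G) : set G := match i with
  | inl i => [set g | signed_centralizer a (g ^ tau i)%g]
  | inr f => [set g | commute g f] end.
pose r (i : nat + G) : seq G := match i with
  | inl i => [seq (t * (tau i)^-1)%g | t <- T]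
  | inr f => [seq x0 (s, f) | s <- S] end.
pose I := [seq (inl i : nat + G) | i <- iota 0 m] ++
  [seq (inr f : nat + G) | f <- F & f != 1%g].
have [|x hx] := @cosets_not_cover G _ I H r.
  move=> i; rewrite mem_cat => /orP[/mapP[j _ ->]|/mapP[f + ->]] /=.
    split; last exact: infinite_index_conj.
    move=> g h /= Hg Hh; rewrite conjMg conjVg.
    by apply: signed_centralizerM => //; exact: signed_centralizerV.
  rewrite mem_filter => /andP[/eqP f1 _]; split; last exact: centralizer_infinite_index.
  move=> g h /= gf hf; apply: commute_sym; apply: commuteM; first exact: commute_sym.
  by apply: commuteV; exact: commute_sym.
have [[i im hi]|bad] := pselect (exists2 i, (i < m)%N & forall s, s \in S ->
    s <> 1%g -> ~ commute (s ^ (x * tau i))%g a).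
  exists (x * tau i)%g; split=> // t tT.
  have := hx (inl i) _ (t * (tau i)^-1)%g (map_f _ tT) => /=.
  rewrite invgM invgK conjgE !mulgA mulVg mul1g; apply.
  by rewrite mem_cat; apply/orP; left; apply: map_f; rewrite mem_iota.
have /choice[sg hsg] : forall i, exists s, (i < m)%N ->
    [/\ s \in S, s <> 1%g & commute (s ^ (x * tau i))%g a].
  move=> i; have [im|] := boolP (i < m)%N; last by exists 1%g.
  apply: contrapT => ns; apply: bad; exists i => // s sS s1 sc.
  by apply: ns; exists s.
have [i [j [ijm e]]] := @pigeonhole_nat _ sg S m
  (fun i im => let: And3 h _ _ := hsg i im in h) (ltnSn _).
have /andP[ij jm] := ijm.
have [sS s1 ci] := hsg i (ltn_trans ij jm); have [_ _ cj] := hsg j jm.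
rewrite -e conjgM in cj; rewrite conjgM in ci.
set s := sg i in sS s1 ci cj.
exfalso; apply: (hx (inr (s ^ x)%g) _ (x0 (s, s ^ x)%g)) => /=.
- rewrite mem_cat; apply/orP; right; apply: map_f.
  rewrite mem_filter conjg_eq1; apply/andP; split; first exact/eqP.
  exact: hF ijm _ ci cj.
- by apply/mapP; exists s.
- apply/commute_sym/commgP/conjg_fixP.
  have e0 : (s ^ x0 (s, s ^ x) = s ^ x)%g := hx0 (s, s ^ x)%g x erefl.
  by rewrite -{1}e0 -conjgM mulVKg.
Qed.

Lemma independent_family (S : seq G) (n : nat) : exists e : nat -> G,
  (forall i, (i < n)%N -> forall s, s \in S -> s <> 1%g -> ~ commute (s ^ e i)%g a) /\
  (forall i j, (i < n)%N -> (j < n)%N -> i <> j -> forall s, s \in S ->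
     ~ signed_centralizer a ((e i)^-1 * s * e j)%g).
Proof.
(* The greedy choice only controls pairs with [i < j]; adding the inverses covers the others. *)
pose S' := S ++ [seq s^-1%g | s <- S].
have [e [he1 he2]] := @greedy_family G
  (fun x => forall s, s \in S -> s <> 1%g -> ~ commute (s ^ x)%g a)
  (fun y x => forall s, s \in S' -> ~ signed_centralizer a (y^-1 * s * x)%g) n
  ltac:(move=> r; have [z [z1 z2]] := avoid_stabilizers S
     [seq (s^-1 * y)%g | s <- S', y <- r];
   exists z; split=> // y yr s sS;
   have := z2 (s^-1 * y)%g; rewrite invgM invgK; apply;
   by apply/allpairsP; exists (s, y)).
exists e; split=> // i j ni nj ij s sS.
case: (ltngtP i j) => // lt.
  by apply: he2; rewrite ?lt ?nj// mem_cat sS.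
move=> /signed_centralizerV; rewrite !invgM invgK mulgA.
by apply: he2; rewrite ?lt ?ni// mem_cat map_f ?orbT.
Qed.

End TrivialRadical.

(** * Reduced forms in G * F_n *)

Section GroupMorphism.
Context {G H : groupType} (f : {multiplicative G -> H}).

Lemma multiplicative1 : f 1%g = 1%g.
Proof. by apply: (@mulgI _ (f 1%g)); rewrite -gmulfM !mulg1. Qed.

Lemma multiplicativeV x : f x^-1%g = (f x)^-1%g.
Proof.
by apply: (@mulgI _ (f x)); rewrite -gmulfM !mulgV multiplicative1.
Qed.

End GroupMorphism.

Section NormalForm.
Context {G : groupType} {n : nat}.

Local Notation P := (free_product G (free_group 'I_n)).
Local Notation syllable := ('I_n * bool * G)%type.

Definition dual_letter (x : 'I_n * bool) : 'I_n * bool := (x.1, ~~ x.2).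

Definition letter_elt (x : 'I_n * bool) : P :=
  signed x.2 (fpr (free_gen x.1)).

Definition no_cancel (p q : syllable) : bool :=
  ~~ ((q.1 == dual_letter p.1) && (p.2 == 1%g)).

Definition has_reduced_form (w : P) : Prop := exists (g0 : G) (l : seq syllable),
  sorted no_cancel l /\
  w = (fpl g0 * \prod_(p <- l) (letter_elt p.1 * fpl p.2))%g.

Lemma reduced_form_coef g w : has_reduced_form w -> has_reduced_form (fpl g * w)%g.
Proof.
by case=> g0 [l [sl ->]]; exists (g * g0)%g, l; rewrite fplM mulgA.
Qed.

Lemma letter_elt_dual x : (letter_elt x * letter_elt (dual_letter x))%g = 1%g.
Proof. by rewrite /letter_elt /= signedN mulgV. Qed.

Lemma reduced_form_letter x w : has_reduced_form w ->
  has_reduced_form (letter_elt x * w)%g.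
Proof.
have fpl1 : fpl 1%g = 1%g :> P by exact: multiplicative1.
case=> g0 [l [sl ->]].
have push : (if l is q :: _ then no_cancel (x, g0) q else true) ->
    has_reduced_form (letter_elt x *
      (fpl g0 * \prod_(p <- l) (letter_elt p.1 * fpl p.2)))%g.
  move=> hl; exists 1%g, ((x, g0) :: l); split; last by rewrite big_cons fpl1 mul1g mulgA.
  by case: l sl hl => //= q l -> ->.
case: l sl push => [|q l] sl push; first exact: push.
have [/andP[/eqP qx /eqP g01]|nc] := boolP ((q.1 == dual_letter x) && (g0 == 1%g)).
  exists q.2, l; split; first exact: path_sorted sl.
  rewrite big_cons g01 fpl1 mul1g qx !mulgA letter_elt_dual mul1g.
  by [].
exact: push.
Qed.

Lemma reduced_formP w : has_reduced_form w.
Proof.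
(* Generators from the right factor are arbitrary elements of the free group, so they are prepended
   letter by letter. *)
have right_factor (v : word 'I_n) w' : has_reduced_form w' ->
    has_reduced_form (fpr (word_class set0 v : free_group 'I_n) * w')%g.
  elim: v => [|[i b] v IHv] hw.
    by rewrite [fpr _]multiplicative1 mul1g.
  rewrite -cat1s word_class_cat fprM -mulgA.
  suff -> : fpr (word_class set0 [:: (i, b)] : free_group 'I_n) = letter_elt (i, b) :> P.
    by apply: reduced_form_letter; exact: IHv.
  case: b; first by [].
  by rewrite (word_class_flip set0 (i, true)) [LHS]multiplicativeV.
rewrite -(word_class_repr w); elim: (repr w) => [|[[x|y] b] u IHu].
- exists 1%g, [::]; split=> //; rewrite big_nil mulg1.
  by rewrite [fpl _]multiplicative1.
- rewrite -cat1s word_class_cat; case: b; first exact: reduced_form_coef.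
  rewrite (word_class_flip _ (inl x, true)).
  rewrite -[(word_class _ _)^-1%g](multiplicativeV fpl).
  exact: reduced_form_coef.
- rewrite -cat1s word_class_cat; case: b.
    rewrite -(word_class_repr y); exact: right_factor.
  rewrite (word_class_flip _ (inr y, true)).
  rewrite -[(word_class _ _)^-1%g](multiplicativeV fpr) -(word_class_repr y^-1%g).
  exact: right_factor.
Qed.

Lemma substitution_exists (h : 'I_n -> G) :
  exists f : {multiplicative P -> G}, (forall g, f (fpl g) = g) /\
    forall x, f (letter_elt x) = signed x.2 (h x.1).
Proof.
have [k [hk _]] := free_group_universal h.
have [f [f1 f2 _]] := free_product_universal idfun k.
exists f; split=> [//|[i b]]; rewrite /letter_elt /=.
by case: b => /=; rewrite ?multiplicativeV f2 hk.
Qed.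

End NormalForm.

(** * Substituting large powers *)

Section LargePowers.
Context {R : realType} {G : groupType} (D : G -> G -> R) (delta : R).
Hypotheses (hD : pseudodist D) (hinv : left_invariant D).
Hypotheses (h4 : four_point D delta) (delta_gt0 : 0 < delta).
Context (C k : R) (a : G).
Hypotheses (la : loxodromic D C k a) (sa : separated_axes D a).
Context {n : nat} (e : 'I_n * bool -> G) (l : seq ('I_n * bool * G)).
Hypothesis he_self : forall x p, p \in l -> p.2 <> 1%g ->
  ~ commute (p.2 ^ e x)%g a.
Hypothesis he_diff : forall x y p, x <> y -> p \in l ->
  ~ signed_centralizer a ((e x)^-1 * p.2 * e y)%g.

Local Notation len := (D 1%g).
Local Notation gp := (gromov D 1%g).

Lemma gp_sandwich x A y x' A' y' :
  gp (x * A * y)%g (x' * A' * y')%g <=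
    gp A (x^-1 * x' * A')%g + (len x + len y + len y').
Proof.
have b1 := gromov_shift hD 1%g (x * A * y)%g (x' * A' * y')%g (x' * A')%g.
have b2 := gromov_shift hD 1%g (x' * A')%g (x * A * y)%g (x * A)%g.
have b3 := gromov_base hD 1%g x (x * A)%g (x' * A')%g.
have [_ Ds _] := hD.
have := gromov_left hinv x 1%g A (x^-1 * x' * A')%g.
rewrite mulg1 -(mulgA x^-1%g) mulVKg.
rewrite (Ds (x' * A' * y')%g) (dist_len hinv (x' * A')%g) mulKg in b1.
rewrite (Ds (x * A * y)%g) (dist_len hinv (x * A)%g) mulKg in b2.
rewrite (gromovC hD 1%g (x' * A')%g) (gromovC hD 1%g (x' * A')%g) in b2.
lra.
Qed.

(** A letter starts at its own translate and ends at that of its dual, so the value of the inverse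
    letter, being the inverse, has the same shape with [a^-1] for [a]. *)
Definition power_syllable (M : nat) (p : 'I_n * bool * G) : G :=
  (e p.1 * signed p.1.2 a ^+ M * (e (dual_letter p.1))^-1 * p.2)%g.

Lemma power_syllable_turn p q : p \in l -> no_cancel p q ->
  exists B, forall M, gp (power_syllable M p)^-1%g (power_syllable M q) <= B.
Proof.
move=> pl npq.
pose g := ((p.2^-1 * e (dual_letter p.1))^-1 * e q.1)%g.
have gE : g = ((e (dual_letter p.1))^-1 * p.2 * e q.1)%g by rewrite /g invgM invgK.
have [|B hB] := sa (b := ~~ p.1.2) (b' := q.1.2) (g := g).
  (* If [q] begins with the inverse letter of [p], then [g] is a conjugate of a nontrivial
     coefficient and intertwining means commuting with [a]; otherwise two different translates are
     compared. *)
  have [qp|qp] := eqVneq q.1 (dual_letter p.1).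
    have p1 : p.2 <> 1%g by move=> p1; move: npq; rewrite /no_cancel qp p1 !eqxx.
    have -> : g = (p.2 ^ e (dual_letter p.1))%g by rewrite gE qp conjgE mulgA.
    have := he_self (x := dual_letter p.1) pl p1.
    move: (p.2 ^ _)%g => h hc; rewrite qp /=; case: (~~ p.1.2) => //= he.
    by apply: hc; have := intertwineV he; rewrite invgK.
  rewrite gE.
  move=> he; apply: (he_diff (x := dual_letter p.1) (y := q.1) _ pl).
    by move=> h; rewrite h eqxx in qp.
  move: he; case: q.1.2 => /= he; first by exists (~~ p.1.2).
  by exists p.1.2; have := intertwineV he; rewrite invgK signedN invgK.
exists (B + (len (p.2^-1 * e (dual_letter p.1))%g + len (e p.1)^-1%g
  + len ((e (dual_letter q.1))^-1 * q.2)%g)) => M.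
have -> : (power_syllable M p)^-1%g =
    (p.2^-1 * e (dual_letter p.1) * signed (~~ p.1.2) a ^+ M * (e p.1)^-1)%g.
  by rewrite /power_syllable !invgM invgK signedN expVgn !mulgA.
rewrite /power_syllable -(mulgA _ _ q.2).
apply: le_trans (gp_sandwich _ _ _ _ _ _) _.
by rewrite lerD2r; exact: hB.
Qed.

Lemma power_syllable_path s (p : 'I_n * bool * G) : {subset p :: s <= l} ->
  path no_cancel p s -> exists2 B : R, 0 <= B & forall M,
  path (fun u v => gp u^-1%g v <= B) (power_syllable M p) (map (power_syllable M) s).
Proof.
elim: s p => [|q s IHs] p sub /=; first by exists 0.
move=> /andP[pq qs].
have [|B1 B10 hB1] := IHs q _ qs.
  by move=> x xs; apply: sub; rewrite inE xs orbT.
have [|B2 hB2] := @power_syllable_turn p q _ pq; first exact/sub/mem_head.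
exists (Num.max B1 B2); first by rewrite le_max B10.
move=> M; rewrite le_max hB2 orbT /=.
by apply: sub_path (hB1 M) => u v h; rewrite le_max h.
Qed.

Lemma power_syllables_neq (g0 : G) : l <> [::] -> sorted no_cancel l ->
  exists M, (g0 * \prod_(p <- l) power_syllable M p)%g <> 1%g.
Proof.
have d0 := delta_gt0.
case: l (@power_syllable_path) => [//|p s] hpath _ sorted_s.
have [B B0 hB] := hpath s p (fun _ => id) sorted_s.
(* Steps of length [X] make the product at least [1] longer than [g0], so it cannot be the inverse
   of [g0]. *)
pose X : R := 2 * B + 2 * delta + len g0 + 1.
have g00 := len_ge0 hD g0.
have [m _ hm] := seq_bounded (p :: s) (fun q : 'I_n * bool * G =>
  len (e q.1) + len (e (dual_letter q.1)) + len q.2).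
have [M hM] := len_expg_large la (X + m).
exists M => prod1.
have long q : q \in p :: s -> X <= len (power_syllable M q).
  move=> /hm hq; have := hM M (leqnn M).
  have aM : len (a ^+ M)%g = len (signed q.1.2 a ^+ M)%g.
    by case: q.1.2 => //=; rewrite expVgn lenV.
  have uE : (signed q.1.2 a ^+ M = (e q.1)^-1 *
      (power_syllable M q * (q.2^-1 * e (dual_letter q.1))))%g.
    by rewrite /power_syllable !mulgA mulgK mulgVK mulVg mul1g.
  rewrite aM uE.
  have := lenM hD hinv (e q.1)^-1%g (power_syllable M q * (q.2^-1 * e (dual_letter q.1)))%g.
  have := lenM hD hinv (power_syllable M q) (q.2^-1 * e (dual_letter q.1))%g.
  have := lenM hD hinv q.2^-1%g (e (dual_letter q.1)).
  rewrite !lenV//; lra.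
have [|||_ ] := @len_gap_chain R G D delta hD hinv h4 d0 B X 1%g
    (map (power_syllable M) (p :: s)) B0.
- by rewrite /X; lra.
- by rewrite /= invg1 gromov_zz// B0 hB.
- by apply/allP => _ /mapP[q qs ->]; exact: long.
rewrite big_map size_map => h.
have : len (\prod_(q <- p :: s) power_syllable M q)%g = len g0.
  by rewrite -(mulg1_eq prod1) lenV.
have : X - 2 * B - 2 * delta <= (size (p :: s))%:R * (X - 2 * B - 2 * delta).
  by rewrite ler_peMl ?ler1n// /X; lra.
by move: h; rewrite /X; lra.
Qed.

End LargePowers.

Theorem corollary1p7 (R : realType) (G : groupType)
    (hG : acylindrically_hyperbolic R G)
    (hK : is_finite_radical [set 1%g : G]) :
  mixed_identity_free G.
Proof.
move=> [n [w [w1 hw]]].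
have [hvc [X [act [hX [hgeo [delta0 hslim]] hact hacy hunb]]]] := hG.
(* [delta0] may fail to be positive; the factor [3] is that of [slim_four_point]. *)
pose delta : R := 3 * Num.max delta0 1.
have d0 : 0 < delta by rewrite mulr_gt0// lt_max ltr01 orbT.
have h4X : four_point (@mdist R X) delta.
  apply: slim_four_point hgeo _ => x y z cxy cyz cxz g1 g2 g3 t tI.
  case: (hslim _ _ _ _ _ _ g1 g2 g3 t tI) => -[s sI sd]; [left|right];
    by exists s => //; rewrite le_max sd.
have [o [C [k [c lc]]]] := loxodromic_exists hact hunb hX hgeo h4X d0 hacy.
set D := orbit_dist act o in lc.
have hD : pseudodist D := orbit_pseudodist act o.
have hinv : left_invariant D := orbit_left_invariant hact o.
have h4 : four_point D delta := @orbit_four_point _ _ _ act o _ h4X.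
have hacyD : acylindrical_dist D.
  move=> eps eps0; have [r [N [_ _ hN]]] := hacy eps eps0; exists r, N => x y xy.
  apply: card_le_trans (hN _ _ xy); apply: subset_card_le => g /=.
  by case: hact => _ actM _; rewrite /D /orbit_dist !actM.
have [a [la sa]] := separated_axes_exists hD hinv h4 d0 hacyD lc.
have hinf : infinite_index (signed_centralizer a).
  move=> s; apply: contrapT => nx; apply: hvc.
  apply: (finitely_many_cosets_virtually_cyclic hD hinv h4 d0 hacyD la (s := s)).
  move=> x; apply: contrapT => nt; apply: nx; exists x => t ts tx.
  by apply: nt; exists t.
have [g0 [l [sl wE]]] := reduced_formP w.
(* One translate for each of the [2 n] letters, in general position with respect to the coefficients
   of the reduced form. *)
have [e0 [e1 e2]] := independent_family
  (commute_expgI hD hinv la sa) (centralizer_meet_finite hD hinv h4 d0 hacyD la sa)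
  hinf hK [seq p.2 | p <- l] #|{: 'I_n * bool}|.
pose e (x : 'I_n * bool) := e0 (enum_rank x).
have hself x p : p \in l -> p.2 <> 1%g -> ~ commute (p.2 ^ e x)%g a.
  by move=> pl; apply: e1 => //; exact: map_f.
have hdiff x y p : x <> y -> p \in l ->
    ~ signed_centralizer a ((e x)^-1 * p.2 * e y)%g.
  move=> xy pl; apply: e2 => //; last exact: map_f.
  by move=> /ord_inj/enum_rank_inj.
have evalE (h : 'I_n -> G) : (g0 * \prod_(p <- l) (signed p.1.2 (h p.1.1) * p.2))%g = 1%g.
  have [f [f1 f2]] := substitution_exists h.
  rewrite -[RHS](hw f f1) wE gmulfM f1; congr (_ * _)%g.
  rewrite (big_morph f (@gmulfM _ _ f) (multiplicative1 f)).
  by apply: eq_bigr => p _; rewrite gmulfM f1 f2.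
have [l0|l0] := eqVneq l [::].
  have := evalE (fun=> 1%g); rewrite l0 big_nil mulg1 => g01.
  by apply: w1; rewrite wE l0 big_nil mulg1 g01 [LHS]multiplicative1.
have [|M] := power_syllables_neq hD hinv h4 d0 la sa hself hdiff g0 _ sl.
  exact/eqP.
apply.
(* Inverse letters also become power syllables, since inversion swaps the two translates. *)
rewrite -[RHS](evalE (fun i => e (i, true) * a ^+ M * (e (i, false))^-1)%g).
congr (_ * _)%g; apply: eq_bigr => -[[i b] g] _; rewrite /power_syllable /dual_letter /=.
by case: b => //=; rewrite !invgM invgK expVgn !mulgA.
Qed.
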